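(* Let $\mathbb{F}$ be a field of characteristic zero. Let $P \in \mathbb{F}[x_1,\dots,x_n]$ be a nonzero polynomial of degree at most $r$ that can be computed by an arithmetic circuit of size $s$ and depth at most $\Delta$. Let $f\in \mathbb{F}[x_1,\dots,x_n]$ be an irreducible polynomial of degree at most $d$ such that $f$ divides $P$. Then $f$ can be computed by an arithmetic circuit of depth at most $\Delta + O(1)$ and size at most $O(\mathrm{poly}(s, r, n)\cdot d^{O(\sqrt{d})})$, where the $O(\cdot)$ constants and the polynomial $\mathrm{poly}$ are absolute (independent of $n,r,s,d,\Delta$).
   Context: An arithmetic circuit over $\mathbb{F}$ in variables $x_1,\dots,x_n$ is a directed acyclic graph whose in-degree-zero nodes are labeled by field elements or variables and whose internal nodes are sum ($+$) or product ($\times$) gates of unbounded fan-in; it computes polynomials in the natural way. Its size is the number of wires and its depth is the length of the longest path from an output to an input. Circuits are assumed layered, with alternating layers of sum and product gates, and with the top (output) layer consisting of sum gates. *)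

(* Defs.v *)
From HB Require Import structures.
From mathcomp Require Import all_boot all_order all_algebra.
From mathcomp.multinomials Require Import mpoly.

Set Implicit Arguments.
Unset Strict Implicit.
Unset Printing Implicit Defensive.

Import GRing.Theory.
Local Open Scope ring_scope.

Inductive label (F : Type) (n : nat) : Type :=
  | Const of F
  | Var of 'I_n
  | Sum
  | Prod.

Arguments Sum {F n}.
Arguments Prod {F n}.

Definition is_input (F : Type) (n : nat) (l : label F n) : bool :=
  match l with
  | Const _ | Var _ => true
  | Sum | Prod => false
  end.

(* [wires v] lists the sources of the wires entering [v]; a repeated entry is
   a pair of parallel wires, as in a gate squaring another one. *)
Record circuit (F : Type) (n : nat) : Type := Circuit {
  node : finType;
  node_label : node -> label F n;
  wires : node -> seq node;
  output : node;
  input_wires : forall v : node,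
    is_input (node_label v) = nilp (wires v);
  circuit_acyclic : forall p : seq node,
    cycle (fun v u : node => u \in wires v) p -> p = [::]
}.

Definition circuit_size (F : Type) (n : nat) (C : circuit F n) : nat :=
  (\sum_(v : node C) size (wires v))%N.

(* By acyclicity, a path has fewer wires than the circuit has nodes. *)
Definition circuit_depth (F : Type) (n : nat) (C : circuit F n) : nat :=
  (\max_(k < #|node C|
     | [exists p : k.-tuple (node C),
          path (fun v u => u \in wires v) (output C) p
          && is_input (node_label (last (output C) p))]) k)%N.

(* Layers are numbered downwards from the output layer, which is layer 0, so
   that sum gates are on even layers and product gates on odd ones. An input
   may be on any layer but the output layer. *)
Definition layered (F : Type) (n : nat) (C : circuit F n) : Prop :=
  exists layer : node C -> nat,
    [/\ layer (output C) = 0%N,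
        forall v u : node C, u \in wires v -> layer u = (layer v).+1,
        forall v : node C, layer v = 0%N -> node_label v = Sum
      & forall v : node C,
          match node_label v with
          | Sum => ~~ odd (layer v)
          | Prod => odd (layer v)
          | _ => true
          end].

(* The equations determine [val] uniquely, as the circuit is acyclic. *)
Definition computes (F : fieldType) (n : nat) (C : circuit F n)
    (P : {mpoly F[n]}) : Prop :=
  exists val : node C -> {mpoly F[n]},
    (forall v : node C, val v =
       match node_label v with
       | Const c => c%:MP
       | Var i => 'X_i
       | Sum => \sum_(u <- wires v) val u
       | Prod => \prod_(u <- wires v) val u
       end)
    /\ val (output C) = P.

Definition irreducible_mpoly (F : fieldType) (n : nat) (f : {mpoly F[n]}) :
    Prop :=
  [/\ f != 0,
      f \isn't a GRing.unit
    & forall g h : {mpoly F[n]}, f = g * h ->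
        g \is a GRing.unit \/ h \is a GRing.unit].

Definition mpoly_divides (F : fieldType) (n : nat) (f P : {mpoly F[n]}) :
    Prop :=
  exists q : {mpoly F[n]}, P = q * f.

(* Main.v *)
(** Write [P = f ^ e * g] with [f] not dividing [g]. Irreducible polynomials are
prime (Gauss), so on a generic line [y |-> a + y b] the restrictions [f0], [g0]
of [f], [g] are coprime, [f0 0 <> 0], and [f0] has degree [deg f]. Along the
plane [(y, z) |-> a + z (x - a) + y b], as power series in [z],

  [log (P / P0) = e * log (f / f0) + log (g / g0)],

where the coefficients of the two summands on the right are proper fractions in
[y] whose denominators are powers of [f0] and of [g0] respectively. Hence
partial fraction decomposition recovers [log (f / f0)] at [y = 0] from
[log (P / P0)] by an [F]-linear functional that does not depend on [x], and such
a functional is a combination of evaluations at [y = 0, 1, 2, ...]. Applying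
[exp], and truncating at [z]-degree [deg f] by interpolation in [z], one gets

  [f x = sum_(s, j) beta_(s, j) *
     (sum_(t, m) gamma_(t, m) * P (a + s (x - a) + t b) ^ m) ^ j]

with polynomially many terms: two layers of sums of products on top of affine
substitutions into the given circuit. The size obtained is thus polynomial in
[s + r + n], without any factor [d ^ O(sqrt d)]. *)

From HB Require Import structures.
Require Import Defs.
From mathcomp Require Import all_boot all_order all_algebra.
From mathcomp.multinomials Require Import mpoly.
From mathcomp Require Import ring zify.
From Stdlib Require Import Classical.

Set Implicit Arguments.
Unset Strict Implicit.
Unset Printing Implicit Defensive.

Import GRing.Theory.
Local Open Scope ring_scope.

(** * Irreducible polynomials are prime *)

Section Divisibility.
Variable R : idomainType.

Definition divides (p u : R) : Prop := exists q, u = q * p.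

Definition irreducible_elt (p : R) : Prop :=
  [/\ p != 0, p \isn't a GRing.unit
    & forall g h, p = g * h -> g \is a GRing.unit \/ h \is a GRing.unit].

Definition prime_elt (p : R) : Prop :=
  forall u v, divides p (u * v) -> divides p u \/ divides p v.

Lemma divides_mull p u v : divides p v -> divides p (u * v).
Proof. by case=> q ->; exists (u * q); rewrite mulrA. Qed.

Lemma divides_mulr p u v : divides p u -> divides p (u * v).
Proof. by move=> ?; rewrite mulrC; apply: divides_mull. Qed.

Lemma dividesD p u v : divides p u -> divides p v -> divides p (u + v).
Proof. by move=> [q ->] [q' ->]; exists (q + q'); rewrite mulrDl. Qed.

Lemma dividesN p u : divides p u -> divides p (- u).
Proof. by case=> q ->; exists (- q); rewrite mulNr. Qed.

End Divisibility.

(** * Gauss's lemma: primality of irreducible elements passes from [R] to [{poly R}] *)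

Section Gauss.
Variable R : idomainType.
Implicit Types (p c : R) (u v f h k : {poly R}).

(* Induction on [size u + size v], removing a leading term divisible by [p]. *)
Lemma prime_polyC p : prime_elt p -> prime_elt p%:P.
Proof.
move=> p_prime u v; move sz: (size u + size v)%N => n.
elim/ltn_ind: n u v sz => n IH u v sz puv.
have [->|nz_u] := eqVneq u 0; first by left; exists 0; rewrite mul0r.
have [->|nz_v] := eqVneq v 0; first by right; exists 0; rewrite mul0r.
have lower (w : {poly R}) : w != 0 -> exists2 w' : {poly R}, (size w' < size w)%N &
    w = w' + (lead_coef w)%:P * 'X^((size w).-1).
  move=> nz_w; exists (\poly_(i < (size w).-1) w`_i).
    by rewrite (leq_ltn_trans (size_poly _ _)) // ltn_predL size_poly_gt0.
  apply/polyP=> i; rewrite coefD coef_poly coefCM coefXn lead_coefE.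
  case: (ltngtP i (size w).-1) => [_|gt|->]; rewrite ?mulr0 ?addr0 ?mulr1 ?add0r //.
  by rewrite nth_default // -(prednK (n := size w)) ?size_poly_gt0.
(* [p] divides every coefficient of [u * v], in particular the leading one. *)
have : divides p (lead_coef u * lead_coef v).
  case: puv => q Eq; exists q`_((size u).-1 + (size v).-1).
  have := congr1 (fun w : {poly R} => w`_((size u).-1 + (size v).-1)) Eq.
  rewrite coefMC -lead_coefM lead_coefE size_mul // => <-.
  by rewrite -(prednK (n := size u)) ?size_poly_gt0 // -(prednK (n := size v))
    ?size_poly_gt0 // addnS addSn.
case/p_prime=> [pl|pl].
- have [u' su' Eu] := lower u nz_u.
  have pt : divides p%:P ((lead_coef u)%:P * 'X^((size u).-1)).
    by apply: divides_mulr; case: pl => q ->; exists q%:P; rewrite polyCM.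
  have : divides p%:P (u' * v).
    have -> : u' * v = u * v + - ((lead_coef u)%:P * 'X^((size u).-1) * v).
      by rewrite {1}Eu mulrDl addrK.
    by apply: dividesD => //; apply/dividesN/divides_mulr.
  case/(IH (size u' + size v)%N) => //; first by rewrite -sz ltn_add2r.
  - by move=> pu'; left; rewrite Eu; apply: dividesD.
  - by right.
- have [v' sv' Ev] := lower v nz_v.
  have pt : divides p%:P ((lead_coef v)%:P * 'X^((size v).-1)).
    by apply: divides_mulr; case: pl => q ->; exists q%:P; rewrite polyCM.
  have : divides p%:P (u * v').
    have -> : u * v' = u * v + - (u * ((lead_coef v)%:P * 'X^((size v).-1))).
      by rewrite {1}Ev mulrDr addrK.
    by apply: dividesD => //; apply/dividesN/divides_mull.
  case/(IH (size u + size v')%N) => //; first by rewrite -sz ltn_add2l.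
  - by left.
  - by move=> pv'; right; rewrite Ev; apply: dividesD.
Qed.

(** A measure that drops when an irreducible factor is split off; constant multipliers are cleared
    below by induction on it. *)
Variable mu : R -> nat.
Hypothesis irr_prime : forall p, irreducible_elt p -> prime_elt p.
Hypothesis mu_factor : forall c, c != 0 -> c \is a GRing.unit \/
  exists p q, [/\ c = q * p, irreducible_elt p & (mu q < mu c)%N].

Lemma polyC_unit c : (c%:P \is a GRing.unit) = (c \is a GRing.unit).
Proof.
rewrite poly_unitE coefC eqxx size_polyC.
by have [->|_] := eqVneq c 0; rewrite ?unitr0 ?andbF.
Qed.

(** Irreducible factors [p] of [c] are removed one at a time. Being prime, [p%:P] divides [f] or
    [w]; if it divided [f], the cofactor would be a unit and [f] a constant, against [1 < size f].
    So it cancels against [w]. *)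
Lemma irreducible_poly_cancel c u f w : irreducible_elt f -> (1 < size f)%N ->
  c != 0 -> c%:P * u = f * w -> divides f u.
Proof.
move=> [nz_f nu_f f_irr] sf; move mc: (mu c) => n.
elim/ltn_ind: n c w mc => n IH c w mc nz_c Ecu.
have [uc|[p [q [Ec p_irr ltq]]]] := mu_factor nz_c.
  exists (c^-1%:P * w); rewrite -mulrA [w * _]mulrC -Ecu mulrA -polyCM mulVr //.
  by rewrite mul1r.
have nz_p : p != 0 by case: p_irr.
have nz_q : q != 0 by apply: contra_neq nz_c => Eq; rewrite Ec Eq mul0r.
have : divides p%:P (f * w).
  by exists (q%:P * u); rewrite -Ecu Ec polyCM -!mulrA [p%:P * u]mulrC.
case/(prime_polyC (irr_prime p_irr)) => [[f' Ef]|[w' Ew]].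
  have [uf'|] := f_irr _ _ Ef; last by rewrite polyC_unit; case: p_irr => _ /negP.
  move: sf; rewrite Ef mulrC size_Cmul //.
  by move: uf'; rewrite poly_unitE => /andP[/eqP-> _].
apply: (IH (mu q) _ q w') => //; first by rewrite -mc.
apply: (mulIf (_ : p%:P != 0)); first by rewrite polyC_eq0.
by rewrite -[RHS]mulrA -Ew -Ecu Ec polyCM; ring.
Qed.

(** Descends a factorization over the fraction field, cleared of denominators by [c], to [R]: each
    irreducible factor of [c] is a prime constant, so it divides [h] or [k] and is cancelled there,
    which keeps the degrees. *)
Lemma scaled_factorization c f h k : c != 0 -> c%:P * f = h * k ->
  exists h' k', [/\ f = h' * k', size h' = size h & size k' = size k].
Proof.
move mc: (mu c) => n; elim/ltn_ind: n c h k mc => n IH c h k mc nz_c Ecf.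
have [uc|[p [q [Ec p_irr ltq]]]] := mu_factor nz_c.
  exists (c^-1%:P * h), k; rewrite -mulrA -Ecf mulrA -polyCM mulVr // mul1r.
  by split=> //; rewrite size_Cmul // invr_eq0.
have nz_p : p != 0 by case: p_irr.
have nz_q : q != 0 by apply: contra_neq nz_c => Eq; rewrite Ec Eq mul0r.
have nz_pP : p%:P != 0 by rewrite polyC_eq0.
have : divides p%:P (h * k).
  by exists (q%:P * f); rewrite -Ecf Ec polyCM -!mulrA [p%:P * f]mulrC.
case/(prime_polyC (irr_prime p_irr)) => [[h1 Eh]|[k1 Ek]].
  have [||h' [k' [Ef sh sk]]] := IH (mu q) _ q h1 k erefl nz_q.
  - by rewrite -mc.
  - apply: (mulIf nz_pP); rewrite [h1 * k * _]mulrAC -Eh -Ecf Ec polyCM; ring.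
  by exists h', k'; rewrite Eh sh sk [h1 * _]mulrC size_Cmul.
have [||h' [k' [Ef sh sk]]] := IH (mu q) _ q h k1 erefl nz_q.
- by rewrite -mc.
- apply: (mulIf nz_pP); rewrite -[RHS]mulrA -Ek -Ecf Ec polyCM; ring.
by exists h', k'; rewrite Ek sh sk [k1 * _]mulrC size_Cmul.
Qed.

(** Let [h] be the gcd of [f] and [u] over the fraction field. The factorization of a multiple of
    [f] through [h] descends to [R], so either the cofactor is constant, and [f] divides a constant
    multiple of [u], or [h] is constant, and the Bezout relation times [v] shows that [f] divides a
    constant multiple of [v]. *)
Lemma irreducible_poly_prime f : irreducible_elt f -> prime_elt f.
Proof.
move=> f_irr; have [nz_f nu_f f_fact] := f_irr.
case: (leqP (size f) 1) => [/size1_polyC Ef|sf].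
  rewrite Ef; apply/prime_polyC/irr_prime; split.
  - by rewrite -polyC_eq0 -Ef.
  - by rewrite -polyC_unit -Ef.
  move=> g h Egh; rewrite -!polyC_unit; apply: f_fact.
  by rewrite Ef Egh polyCM.
move=> u v [w Ew]; set h := gcdp f u.
have [[c q] /= nz_c] := Pdiv.Idomain.dvdpP _ _ (dvdp_gcdl f u).
have [[c1 l] /= nz_c1] := Pdiv.Idomain.dvdpP _ _ (dvdp_gcdr f u).
rewrite -/h -!mul_polyC => Ecu Ecf.
have [q' [h' [Ef sq sh]]] := scaled_factorization nz_c Ecf.
have [uq|uh] := f_fact _ _ Ef.
- move: uq; rewrite poly_unitE sq => /andP[/size_poly1P[k nz_k Ek] _].
  left; apply: (@irreducible_poly_cancel (k * c1) u f (l * c%:P)) => //.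
    by rewrite mulf_neq0.
  by rewrite polyCM -mulrA Ecu -Ek [f * _]mulrCA [f * _]mulrC Ecf; ring.
move: uh; rewrite poly_unitE sh => /andP[/size_poly1P[k nz_k Ek] _].
have [[s t] /= /Pdiv.Idomain.eqpP[[k1 k2] /= /andP[nz_k1 nz_k2]]] :=
  Pdiv.Idomain.Bezoutp f u.
rewrite -/h Ek -!mul_polyC => Ek12.
right; apply: (@irreducible_poly_cancel (k2 * k) v f (k1%:P * (s * v + t * w))) => //.
  by rewrite mulf_neq0.
by rewrite polyCM -Ek12 -mulrA mulrDl -[t * u * v]mulrA Ew; ring.
Qed.

End Gauss.

(** The gcd over the fraction field decides: if it is constant, Bezout holds up to a constant;
    otherwise [q] is, up to a constant, the cofactor of the gcd in [f]. *)
Lemma poly_bezout_or_common_factor (R : idomainType) (f g : {poly R}) : f != 0 ->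
  (exists u v c, c != 0 /\ u * f + v * g = c%:P) \/
  (exists q w : {poly R}, [/\ q != 0, (size q < size f)%N & q * g = w * f]).
Proof.
move=> nz_f; set h := gcdp f g.
have nz_h : h != 0 by rewrite gcdp_eq0 negb_and nz_f.
case: (leqP (size h) 1) => sh; [left | right].
  have /size_poly1P[k nz_k Ek] : size h == 1%N.
    by rewrite eqn_leq sh size_poly_gt0.
  have [[s t] /= /Pdiv.Idomain.eqpP[[k1 k2] /= /andP[nz_k1 nz_k2]]] :=
    Pdiv.Idomain.Bezoutp f g.
  rewrite -/h Ek -!mul_polyC => E.
  exists (k1%:P * s), (k1%:P * t), (k2 * k); split; first by rewrite mulf_neq0.
  by rewrite polyCM -E; ring.
have [[c0 q] /= nz_c0] := Pdiv.Idomain.dvdpP _ _ (dvdp_gcdl f g).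
have [[c1 l] /= nz_c1] := Pdiv.Idomain.dvdpP _ _ (dvdp_gcdr f g).
rewrite -/h -!mul_polyC => Eg Ef.
have nz_q : q != 0.
  apply: contra_neq (_ : c0%:P * f != 0); first by rewrite Ef => ->; rewrite mul0r.
  by rewrite mulf_neq0 ?polyC_eq0.
exists (c1%:P * q), (l * c0%:P); split.
- by rewrite mulf_neq0 ?polyC_eq0.
- rewrite size_Cmul // -(size_Cmul f nz_c0) Ef size_mul //.
  by case: (size h) sh => [|[|k]] // _; rewrite !addnS ltnS leq_addr.
by rewrite -[RHS]mulrA Ef mulrAC Eg; ring.
Qed.

Lemma size_dvd_le (R : idomainType) (f q w : {poly R}) :
  q != 0 -> q = w * f -> (size f <= size q)%N.
Proof.
move=> nz_q Eq; have nz_w : w != 0 by apply: contra_neq nz_q => E; rewrite Eq E mul0r.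
have [-> | nz_f] := eqVneq f 0; first by rewrite size_poly0.
rewrite Eq size_mul //; rewrite -size_poly_gt0 in nz_w.
by case: (size w) nz_w => // k _; rewrite addSn leq_addl.
Qed.

(** * Transport of primality and irreducibility along ring isomorphisms *)

Section Transport.
Variables (A B : idomainType) (phi : {rmorphism A -> B}) (psi : {rmorphism B -> A}).
Hypotheses (phiK : cancel phi psi) (psiK : cancel psi phi).

Lemma prime_elt_iso p : prime_elt (phi p) -> prime_elt p.
Proof.
move=> p_prime u v [q Eq].
have : divides (phi p) (phi u * phi v) by exists (phi q); rewrite -!rmorphM Eq.
case/p_prime=> [[w Ew]|[w Ew]]; [left|right]; exists (psi w).
  by rewrite -[u]phiK Ew rmorphM phiK.
by rewrite -[v]phiK Ew rmorphM phiK.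
Qed.

Lemma irreducible_elt_iso p : irreducible_elt p -> irreducible_elt (phi p).
Proof.
have unitE q : (phi q \is a GRing.unit) = (q \is a GRing.unit).
  by apply/idP/idP => [/(rmorph_unit psi)|/(rmorph_unit phi)]; rewrite ?phiK.
case=> nz_p nu_p p_irr; split.
- by rewrite -(inj_eq (can_inj psiK)) phiK rmorph0.
- by rewrite unitE.
move=> g h Egh; rewrite -[g]psiK -[h]psiK !unitE; apply: p_irr.
by rewrite -rmorphM -Egh phiK.
Qed.

End Transport.

Lemma mpoly_rmorph_eq (R : comNzRingType) n (S : comNzRingType)
    (phi psi : {rmorphism {mpoly R[n]} -> S}) :
  (forall c, phi c%:MP = psi c%:MP) -> (forall i, phi 'X_i = psi 'X_i) ->
  phi =1 psi.
Proof.
move=> EC EX p; rewrite (mpolyE p) !rmorph_sum; apply: eq_bigr => m _.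
rewrite -mul_mpolyC !rmorphM EC mpolyXE_id !rmorph_prod; congr (_ * _).
by apply: eq_bigr => i _; rewrite !rmorphXn EX.
Qed.

Lemma poly_rmorph_eq (R : comNzRingType) (S : comNzRingType)
    (phi psi : {rmorphism {poly R} -> S}) :
  (forall c, phi c%:P = psi c%:P) -> phi 'X = psi 'X -> phi =1 psi.
Proof.
move=> EC EX p; rewrite -(coefK p) poly_def !rmorph_sum; apply: eq_bigr => i _.
by rewrite -mul_polyC !rmorphM !rmorphXn EC EX.
Qed.

(** * The isomorphism of [F[x_0, ..., x_n]] with [F[x_0, ..., x_(n-1)][X]], the last variable
    becoming [X] *)

Section LastVariable.
Variables (F : fieldType) (n : nat).

Definition split_last : {rmorphism {mpoly F[n.+1]} -> {poly {mpoly F[n]}}} :=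
  mmap (polyC \o @mpolyC n F)
    (fun i => if unlift ord_max i is Some j then ('X_j)%:P else 'X).

Definition widen_last : {rmorphism {mpoly F[n]} -> {mpoly F[n.+1]}} :=
  mmap (@mpolyC n.+1 F) (fun i => 'X_(lift ord_max i)).

Definition join_last : {rmorphism {poly {mpoly F[n]}} -> {mpoly F[n.+1]}} :=
  horner_eval 'X_ord_max \o map_poly widen_last.

Lemma split_lastC c : split_last c%:MP = c%:MP%:P.
Proof. by rewrite /= mmapC. Qed.

Lemma split_lastX i : split_last 'X_(lift ord_max i) = ('X_i)%:P.
Proof. by rewrite /= mmapX mmap1U liftK. Qed.

Lemma split_last_max : split_last 'X_ord_max = 'X.
Proof. by rewrite /= mmapX mmap1U unlift_none. Qed.

Lemma widen_lastC c : widen_last c%:MP = c%:MP.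
Proof. by rewrite /= mmapC. Qed.

Lemma widen_lastX i : widen_last 'X_i = 'X_(lift ord_max i).
Proof. by rewrite /= mmapX mmap1U. Qed.

Lemma join_lastC p : join_last p%:P = widen_last p.
Proof. by rewrite /= map_polyC /horner_eval hornerC. Qed.

Lemma join_lastX : join_last 'X = 'X_ord_max.
Proof. by rewrite /= map_polyX /horner_eval hornerX. Qed.

Lemma split_lastK : cancel split_last join_last.
Proof.
apply: (@mpoly_rmorph_eq _ _ _ (join_last \o split_last) idfun) => [c|i];
  rewrite -[LHS]/(join_last (split_last _)) -[RHS]/(id _).
  by rewrite split_lastC join_lastC widen_lastC.
case: (unliftP ord_max i) => [j|] ->.
  by rewrite split_lastX join_lastC widen_lastX.
by rewrite split_last_max join_lastX.
Qed.

Lemma split_widen p : split_last (widen_last p) = p%:P.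
Proof.
move: p.
apply: (@mpoly_rmorph_eq _ _ _ (split_last \o widen_last) polyC) => [c|i];
  rewrite -[LHS]/(split_last (widen_last _)).
  by rewrite widen_lastC split_lastC.
by rewrite widen_lastX split_lastX.
Qed.

Lemma join_lastK : cancel join_last split_last.
Proof.
apply: (@poly_rmorph_eq _ _ (split_last \o join_last) idfun) => [c|];
  rewrite -[LHS]/(split_last (join_last _)).
  by rewrite join_lastC split_widen.
by rewrite join_lastX split_last_max.
Qed.

End LastVariable.

Arguments split_last {F n}.
Arguments join_last {F n}.

(** * Primality of irreducible multivariate polynomials *)

Section IrreduciblePrime.
Variable F : fieldType.

Lemma mpoly_unit_size n (p : {mpoly F[n]}) :
  (p \is a GRing.unit) = (msize p == 1%N).
Proof.
apply/idP/msize_poly1P => [/andP[/eqP Ep up]|[c nz_c ->]].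
  by exists p@_0; [rewrite -unitfE | exact: Ep].
apply/unitrP; exists (c^-1)%:MP; rewrite -!mpolyCM mulVf // mulfV //.
Qed.

(** Supplies [mu_factor] with [mu] the size. A nonunit that is not irreducible is a product of two
    nonunits of positive degree, hence of smaller size, and induction splits an irreducible factor
    off one of them. *)
Lemma mpoly_factor n (c : {mpoly F[n]}) : c != 0 -> c \is a GRing.unit \/
  exists p q, [/\ c = q * p, irreducible_elt p & (msize q < msize c)%N].
Proof.
move ms: (msize c) => k; elim/ltn_ind: k c ms => k IH c ms nz_c.
case: (boolP (c \is a GRing.unit)) => [|nu_c]; [by left | right].
have size_nu (q : {mpoly F[n]}) : q != 0 -> q \isn't a GRing.unit -> (1 < msize q)%N.
  by rewrite mpoly_unit_size -msize_poly_eq0; case: (msize q) => [|[]].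
have [c_irr|not_irr] := classic (irreducible_elt c).
  by exists c, 1; rewrite mul1r msize1 -ms size_nu.
have [g [h [Ec nu_g nu_h]]] : exists g h, [/\ c = g * h,
    g \isn't a GRing.unit & h \isn't a GRing.unit].
  apply: NNPP => no_gh; apply: not_irr; split=> // g h Ec.
  case: (boolP (g \is a GRing.unit)) => [|nu_g]; [by left | right].
  by case: (boolP (h \is a GRing.unit)) => // nu_h; case: no_gh; exists g, h.
have nz_g : g != 0 by apply: contra_neq nz_c => E0; rewrite Ec E0 mul0r.
have nz_h : h != 0 by apply: contra_neq nz_c => E0; rewrite Ec E0 mulr0.
have Es := msizeM nz_g nz_h; rewrite -Ec ms in Es.
have sg := size_nu g nz_g nu_g; have sh := size_nu h nz_h nu_h.
have lt_h : (msize h < k)%N.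
  by rewrite Es; case: (msize g) sg => [|[|a]] // _; rewrite !addSn /= ltnS leq_addl.
have [uh|[p [q [Eh p_irr lt_q]]]] := IH _ lt_h h erefl nz_h.
  by rewrite uh in nu_h.
have nz_q : q != 0 by apply: contra_neq nz_h => E0; rewrite Eh E0 mul0r.
exists p, (g * q); rewrite -mulrA -Eh; split=> //; rewrite msizeM // Es.
by case: (msize g) sg => [|a] // _; rewrite !addSn /= ltn_add2l.
Qed.

(** Induction on the number of variables by Gauss's lemma; without variables every nonzero
    polynomial is a unit. *)
Lemma irreducible_mpoly_prime n (p : {mpoly F[n]}) :
  irreducible_elt p -> prime_elt p.
Proof.
elim: n p => [|n IHn] p p_irr.
  have [nz_p nu_p _] := p_irr; case/negP: nu_p; rewrite mpoly_unit_size.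
  apply/msize_poly1P.
  exists p@_0; last exact: nvar0_mpolyC.
  by apply: contra_neq nz_p => E0; rewrite [p]nvar0_mpolyC E0.
apply: (prime_elt_iso (@split_lastK F n)).
apply: (irreducible_poly_prime IHn (@mpoly_factor n)).
exact: (irreducible_elt_iso (@split_lastK F n) (@join_lastK F n)).
Qed.

End IrreduciblePrime.

(** * Points where a nonzero polynomial does not vanish *)

Lemma natr_inj (F : fieldType) (F0 : [pchar F] =i pred0) :
  injective (fun i : nat => i%:R : F).
Proof.
move=> i j Eij; apply/eqP; wlog le_ij : i j Eij / (i <= j)%N.
  by move=> W; case: (leqP i j) => [/W->//|/ltnW/W]; rewrite eq_sym => ->.
have /pcharf0P/(_ (j - i)%N) := F0; rewrite natrB // -[j%:R]Eij subrr eqxx.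
by move/esym; rewrite subn_eq0 eqn_leq le_ij.
Qed.

Lemma poly_nonroot (F : fieldType) (F0 : [pchar F] =i pred0) (p : {poly F}) :
  p != 0 -> exists t, p.[t] != 0.
Proof.
move=> nz_p; pose s := [seq (i%:R : F) | i <- iota 0 (size p)].
have us : uniq s by rewrite map_inj_uniq ?iota_uniq //; apply: natr_inj.
have := max_poly_roots nz_p _ us; rewrite size_map size_iota ltnn.
case: (boolP (all (root p) s)) => [_ /(_ isT)//|/allPn[t _ nt] _].
by exists t.
Qed.

(** At a point where the leading coefficient in the last variable is nonzero, the polynomial
    specializes to a nonzero univariate one. *)
Lemma mpoly_nonroot (F : fieldType) (F0 : [pchar F] =i pred0) n
  (p : {mpoly F[n]}) : p != 0 -> exists v, p.@[v] != 0.
Proof.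
elim: n p => [|n IHn] p nz_p.
  exists (fun _ => 0); rewrite [p]nvar0_mpolyC mevalC.
  by apply: contra_neq nz_p => E0; rewrite [p]nvar0_mpolyC E0.
have nz_q : split_last p != 0.
  by rewrite -(inj_eq (can_inj (@join_lastK F n))) split_lastK rmorph0.
have [v nz_v] : exists v, (lead_coef (split_last p)).@[v] != 0.
  by apply: IHn; rewrite lead_coef_eq0.
have [t nz_t] : exists t, (map_poly (meval v) (split_last p)).[t] != 0.
  apply: poly_nonroot => //; apply: contra_neq nz_v => E0.
  by rewrite lead_coefE -coef_map E0 coef0.
exists (fun i => if unlift ord_max i is Some j then v j else t).
move: nz_t; congr (_ != 0); move: p {nz_p nz_q nz_v}.
apply: (@mpoly_rmorph_eq _ _ _
  (horner_eval t \o map_poly (meval v) \o split_last) (meval _)) => [c|i];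
  rewrite -[LHS]/((map_poly (meval v) (split_last _)).[t]).
  by rewrite split_lastC map_polyC hornerC /= !mevalC.
rewrite /= mevalXU; case: (unliftP ord_max i) => [j|] ->.
  by rewrite split_lastX map_polyC hornerC /= mevalXU.
by rewrite split_last_max map_polyX hornerX.
Qed.

(** * Restriction to lines *)

Section Lines.
Variables (F : fieldType) (n : nat).
Implicit Types (a b : 'I_n -> F) (p f g : {mpoly F[n]}).

(** The restriction [p (x + X b)] to the line of direction [b] through the generic point [x]. Below,
    [shift b] extends it to an automorphism fixing [X], and [line_at a b] specializes [x] to [a]. *)
Definition line b : {rmorphism {mpoly F[n]} -> {poly {mpoly F[n]}}} :=
  mmap (polyC \o @mpolyC n F) (fun i => ('X_i)%:P + (b i)%:MP *: 'X).

Definition shift b : {rmorphism {poly {mpoly F[n]}} -> {poly {mpoly F[n]}}} :=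
  horner_eval 'X \o map_poly (line b).

Definition line_at a b : {rmorphism {mpoly F[n]} -> {poly F}} :=
  mmap polyC (fun i => (a i)%:P + b i *: 'X).

Lemma lineC b c : line b c%:MP = c%:MP%:P.
Proof. by rewrite /= mmapC. Qed.

Lemma lineX b i : line b 'X_i = ('X_i)%:P + (b i)%:MP *: 'X.
Proof. by rewrite /= mmapX mmap1U. Qed.

Lemma shiftC b p : shift b p%:P = line b p.
Proof. by rewrite /= map_polyC /horner_eval hornerC. Qed.

Lemma shiftX b : shift b 'X = 'X.
Proof. by rewrite /= map_polyX /horner_eval hornerX. Qed.

Lemma line_atC a b c : line_at a b c%:MP = c%:P.
Proof. by rewrite /= mmapC. Qed.

Lemma line_atX a b i : line_at a b 'X_i = (a i)%:P + b i *: 'X.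
Proof. by rewrite /= mmapX mmap1U. Qed.

Opaque line shift line_at.

Lemma shift_line b c p : (forall i, c i = - b i) -> shift c (line b p) = p%:P.
Proof.
move=> Ec; move: p; apply: (@mpoly_rmorph_eq _ _ _ (shift c \o line b) polyC) => [x|i];
  rewrite -[LHS]/(shift c (line b _)).
  by rewrite lineC shiftC lineC.
rewrite lineX rmorphD -mul_polyC rmorphM !shiftC lineX lineC shiftX Ec.
by rewrite -mul_polyC !rmorphN mulNr addrNK.
Qed.

Lemma shiftK b c : (forall i, c i = - b i) -> cancel (shift b) (shift c).
Proof.
move=> Ec; apply: (@poly_rmorph_eq _ _ (shift c \o shift b) idfun) => [p|];
  rewrite -[LHS]/(shift c (shift b _)).
  by rewrite shiftC shift_line.
by rewrite !shiftX.
Qed.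

Lemma meval_line a b p : map_poly (meval a) (line b p) = line_at a b p.
Proof.
move: p; apply: (@mpoly_rmorph_eq _ _ _ (map_poly (meval a) \o line b) (line_at a b))
  => [x|i]; rewrite -[LHS]/(map_poly (meval a) (line b _)).
  by rewrite lineC line_atC map_polyC /= mevalC.
rewrite lineX line_atX rmorphD -mul_polyC rmorphM /= !map_polyC map_polyX /=.
by rewrite mevalXU mevalC mul_polyC.
Qed.

Lemma line_at0 a b p : (line_at a b p).[0] = p.@[a].
Proof.
move: p; apply: (@mpoly_rmorph_eq _ _ _ (horner_eval 0 \o line_at a b) (meval a))
  => [x|i]; rewrite -[LHS]/((line_at a b _).[0]).
  by rewrite line_atC hornerC /= mevalC.
by rewrite line_atX !hornerE /= mevalXU.
Qed.

(** Failing a Bezout relation, [q * line b g = w * line b f] with [q] of smaller degree than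
    [line b f]. Undoing the shift turns [line b f] into the constant [f%:P], which is prime, so it
    divides the unshifted [q] or [g]. The latter is excluded; by the former [line b f] divides [q],
    against the degrees. *)
Lemma line_bezout b f g : f != 0 -> prime_elt f -> ~ divides f g ->
  exists u v c, c != 0 /\ u * line b f + v * line b g = c%:P.
Proof.
move=> nz_f f_prime ndiv; pose c := fun i => - b i.
have Ec i : c i = - b i by [].
have Eb i : b i = - c i by rewrite opprK.
have nz_f1 : line b f != 0.
  by rewrite -shiftC -(inj_eq (can_inj (shiftK Eb))) (shiftK Ec) rmorph0 polyC_eq0.
have [//|[q [w [nz_q sq E]]]] := poly_bezout_or_common_factor (line b g) nz_f1.
have : divides f%:P (shift c q * g%:P).
  exists (shift c w); rewrite -(shift_line f Ec) -(shift_line g Ec).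
  by rewrite -[LHS](rmorphM (shift c)) -[RHS](rmorphM (shift c)) E.
case/(prime_polyC f_prime) => [[k Ek]|[k Ek]]; last first.
  case: ndiv; exists k`_0; have := congr1 (fun u : {poly _} => u`_0) Ek.
  by rewrite coefMC coefC.
have := congr1 (shift b) Ek; rewrite (shiftK Eb) rmorphM shiftC => Es.
by have := size_dvd_le nz_q Es; rewrite leqNgt sq.
Qed.

End Lines.

(** * Lines that keep the degree of [f] and the coprimality of [f] and [g] *)

Section GoodLine.
Variables (F : fieldType) (n : nat).
Implicit Types (a b : 'I_n -> F) (p f g : {mpoly F[n]}).

(** Here [c] may be zero, which makes the notion stable under all products. *)
Definition top_coef (k : nat) (c : F) (p : {poly F}) : Prop :=
  (size p <= k.+1)%N /\ p`_k = c.

Lemma top_coefM k l c d (p q : {poly F}) :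
  top_coef k c p -> top_coef l d q -> top_coef (k + l) (c * d) (p * q).
Proof.
move=> [sp <-] [sq <-]; split.
  by apply: leq_trans (size_polyMleq _ _) _; lia.
have lk : (k < (k + l).+1)%N by lia.
rewrite coefM (bigD1 (Ordinal lk)) //= addKn big1 ?addr0 // => -[i lti] /= ne.
have {}ne : i != k by apply: contraNneq ne => Ei; apply/eqP/val_inj.
case: (ltngtP i k) ne => // [ltik|gtik] _.
  by rewrite [q`_ _]nth_default ?mulr0 //; apply: leq_trans sq _; lia.
by rewrite [p`_i]nth_default ?mul0r //; apply: leq_trans sp _; lia.
Qed.

Lemma top_coef_exp k c (p : {poly F}) m :
  top_coef k c p -> top_coef (k * m) (c ^+ m) (p ^+ m).
Proof.
move=> tp; elim: m => [|m IH]; last by rewrite mulnS !exprS; apply: top_coefM.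
by rewrite muln0 !expr0; split; rewrite ?size_poly1 // coefC.
Qed.

Lemma top_coef_mmap1 a b (m : 'X_{1..n}) :
  top_coef (mdeg m) (\prod_i b i ^+ m i)
    (mmap1 (fun i => (a i)%:P + b i *: 'X) m).
Proof.
rewrite mdegE /mmap1; elim/big_rec3: _ => [|i p c k _ tp].
  by split; rewrite ?size_poly1 // coefC.
apply: top_coefM => //; rewrite -{1}[m i]mul1n; apply: top_coef_exp; split.
  apply: leq_trans (size_polyD _ _) _; rewrite geq_max.
  apply/andP; split; first by apply: leq_trans (size_polyC_leq1 _) _.
  by apply: leq_trans (size_scale_leq _ _) _; rewrite size_polyX.
by rewrite coefD coefC coefZ coefX mulr1 add0r.
Qed.

(** The homogeneous component of top degree. Its value at [b] is the coefficient of degree [deg f]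
    of [f] on any line of direction [b]. *)
Definition top_form f : {mpoly F[n]} :=
  \sum_(m <- msupp f | mdeg m == (msize f).-1) f@_m *: 'X_[m].

Lemma top_form_neq0 f : f != 0 -> top_form f != 0.
Proof.
move=> nz_f; have lf := mlead_supp nz_f.
apply/eqP => /(congr1 (mcoeff (mlead f))); rewrite mcoeff0 raddf_sum /=.
rewrite big_mkcond /= (bigD1_seq (mlead f)) ?msupp_uniq //=.
rewrite -mlead_deg // eqxx mcoeffZ mcoeffX eqxx mulr1 big1 ?addr0 => [/eqP|m ne].
  by apply/negP; rewrite -mcoeff_msupp.
by case: ifP => // _; rewrite mcoeffZ mcoeffX (negPf ne) mulr0.
Qed.

Transparent line_at.
Lemma line_atE a b f : line_at a b f =
  \sum_(m <- msupp f) f@_m *: mmap1 (fun i => (a i)%:P + b i *: 'X) m.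
Proof. by rewrite /= /mmap; apply: eq_bigr => m _; rewrite mul_polyC. Qed.
Opaque line_at.

Lemma size_line_at a b f : f != 0 -> (top_form f).@[b] != 0 ->
  size (line_at a b f) = msize f.
Proof.
move=> nz_f nz_b; apply/anti_leq/andP; split.
  rewrite line_atE big_seq; elim/big_rec: _ => [|m p mf sp].
    by rewrite size_poly0.
  apply: leq_trans (size_polyD _ _) _; rewrite geq_max sp andbT.
  apply: leq_trans (size_scale_leq _ _) _.
  have [+ _] := top_coef_mmap1 a b m; move/leq_trans; apply.
  exact: msize_mdeg_lt.
rewrite -mlead_deg // ltnNge; apply: contra nz_b => le_s.
have := nth_default 0 le_s; rewrite line_atE coef_sum => E0.
apply/eqP; rewrite raddf_sum /= big_mkcond /= -[RHS]E0.
apply: eq_big_seq => m mf.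
have [sm cm] := top_coef_mmap1 a b m.
rewrite coefZ -(mlead_deg nz_f) /=; case: eqP => [<-|ne].
  by rewrite cm mevalZ mevalX.
rewrite nth_default ?mulr0 //; apply: leq_trans sm _.
by have := msize_mdeg_lt mf; rewrite -mlead_deg // ltnS leq_eqVlt => /orP[/eqP/ne|].
Qed.

(** The direction [b] avoids the zeros of the top form, so the degree is kept; then [a] avoids the
    zeros of [f] and of the constant [c] in the generic Bezout relation, which therefore survives
    specialization at [a]. *)
Lemma exists_good_line (F0 : [pchar F] =i pred0) f g :
    f != 0 -> prime_elt f -> ~ divides f g ->
  exists a b, [/\ f.@[a] != 0, size (line_at a b f) = msize f
    & coprimep (line_at a b f) (line_at a b g)].
Proof.
move=> nz_f f_prime ndiv.
have [b nz_b] := mpoly_nonroot F0 (top_form_neq0 nz_f).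
have [u [v [c [nz_c E]]]] := line_bezout b nz_f f_prime ndiv.
have [a] := mpoly_nonroot F0 (mulf_neq0 nz_f nz_c).
rewrite mevalM mulf_eq0 negb_or => /andP[nz_fa nz_ca].
exists a, b; split=> //; first exact: size_line_at.
pose ev : {rmorphism {poly {mpoly F[n]}} -> {poly F}} := map_poly (meval a).
have Ea : ev u * line_at a b f + ev v * line_at a b g = (c.@[a])%:P.
  rewrite -!meval_line -[X in X + _](rmorphM ev) -[X in _ + X](rmorphM ev).
  by rewrite -[LHS](rmorphD ev) E /ev /= map_polyC.
apply/Bezout_coprimepP; exists (ev u, ev v); rewrite [_.1]/= [_.2]/=.
by rewrite Ea -size_poly_eq1 size_polyC nz_ca.
Qed.

End GoodLine.

(** * Truncated logarithm and exponential *)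

Section LowCoefficients.
Variable S : idomainType.
Implicit Types p q h : {poly S}.

Definition zero_below (k : nat) p : Prop := forall i, (i < k)%N -> p`_i = 0.

Lemma zero_below_mulr k p q : zero_below k p -> zero_below k (q * p).
Proof.
move=> p0 i ltik; rewrite coefM big1 // => j _.
by rewrite p0 ?mulr0 //; apply: leq_ltn_trans ltik; apply: leq_subr.
Qed.

Lemma zero_belowD k p q : zero_below k p -> zero_below k q -> zero_below k (p + q).
Proof. by move=> p0 q0 i ltik; rewrite coefD p0 ?q0 ?addr0. Qed.

Lemma zero_belowN k p : zero_below k p -> zero_below k (- p).
Proof. by move=> p0 i ltik; rewrite coefN p0 ?oppr0. Qed.

Lemma zero_below_exp k h : h`_0 = 0 -> zero_below k (h ^+ k).
Proof.
move=> h0 i ltik; have -> : h = drop_poly 1 h * 'X.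
  rewrite -[LHS](poly_take_drop 1) expr1 -[RHS]add0r; congr (_ + _).
  by apply/polyP => j; rewrite coef_take_poly coef0; case: j => [|j] //=.
by rewrite exprMn coefMXn ltik.
Qed.

(** The lowest nonzero coefficient of [q], times the constant term of [p], is a coefficient of
    [p * q]. *)
Lemma zero_below_cancel k p q : p`_0 != 0 -> zero_below k (p * q) -> zero_below k q.
Proof.
move=> nz_p pq0 i; elim/ltn_ind: i => i IH ltik.
have := pq0 i ltik; rewrite coefM big_ord_recl /= subn0 big1 ?addr0.
  by move/eqP; rewrite mulf_eq0 (negPf nz_p) => /eqP.
by move=> j _; rewrite IH ?mulr0 //; case: j => j /= ltj; rewrite /bump; lia.
Qed.

End LowCoefficients.

(** * Series up to order [D], and linear functionals as combinations of evaluations *)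

Section FieldSeries.
Variable F : fieldType.
Hypothesis F0 : [pchar F] =i pred0.

Lemma natr_neq0 k : k.+1%:R != 0 :> F.
Proof. by have /pcharf0P -> := F0. Qed.

(* [p / q] is constant up to order [D] as soon as its derivative vanishes. *)
Lemma proportional_series D c (p q : {poly F}) : q`_0 != 0 -> p`_0 = c * q`_0 ->
  zero_below D (p^`() * q - p * q^`()) ->
  forall i, (i <= D)%N -> p`_i = c * q`_i.
Proof.
move=> nz_q Ep0 low; pose h := p - c *: q.
suff h0 : forall i, (i <= D)%N -> h`_i = 0.
  by move=> i /h0; rewrite coefB coefZ => /eqP; rewrite subr_eq0 => /eqP.
have lowh : zero_below D (h^`() * q - h * q^`()).
  have -> : h^`() * q - h * q^`() = p^`() * q - p * q^`() by
    rewrite /h derivB derivZ -!mul_polyC; ring.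
  exact: low.
elim/ltn_ind => -[_ _|i IH ltiD]; first by rewrite coefB coefZ Ep0 subrr.
(* As the coefficients of [h] up to [i] vanish, coefficient [i] reduces to [(i + 1) h_(i+1) q_0],
   where [i + 1] is invertible in characteristic zero. *)
have := lowh i ltiD; rewrite coefB !coefM big_ord_recr /= subnn big1 ?add0r; last first.
  move=> [j ltj] _ /=; rewrite coef_deriv IH ?mul0rn ?mul0r //; lia.
rewrite big1 ?subr0; last by move=> [j ltj] _ /=; rewrite IH ?mul0r //; lia.
rewrite coef_deriv -mulr_natl => /eqP.
by rewrite !mulf_eq0 (negPf nz_q) (negPf (natr_neq0 i)) orbF => /eqP.
Qed.

(** The nodes [0, ..., N - 1] are distinct in characteristic zero, so their Vandermonde matrix is
    invertible; [nu] is its inverse applied to [c]. *)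
Lemma sample_functional N (c : nat -> F) : exists nu : nat -> F,
  forall h : {poly F}, (size h <= N)%N ->
  \sum_(i < N) c i * h`_i = \sum_(t < N) nu t * h.[t%:R].
Proof.
pose V : 'M[F]_N := Vandermonde N (\row_j (j : nat)%:R).
have uV : V \in unitmx.
  rewrite unitmxE det_Vandermonde unitfE; apply/prodf_neq0 => i _.
  apply/prodf_neq0 => j ltij; rewrite !mxE subr_eq0.
  by apply: contraTneq ltij => /(natr_inj F0) ->; rewrite ltnn.
pose nu := invmx V *m (\col_i c i).
exists (fun t => if insub t is Some j then nu j 0 else 0) => h sh.
pose w : 'rV[F]_N := \row_i h`_i.
transitivity ((w *m \col_i c i) 0 0).
  by rewrite mxE; apply: eq_bigr => i _; rewrite !mxE mulrC.
rewrite -[\col_i c i](mulKVmx uV) -/nu mulmxA mxE; apply: eq_bigr => j _.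
rewrite valK mulrC; congr (_ * _); rewrite mxE (horner_coef_wide _ sh).
by apply: eq_bigr => i _; rewrite !mxE.
Qed.

(* With [w v = 1] modulo [u], the remainder modulo [u] of [w (A v + B u)] is [A],
   the numerator over [u] in the partial fractions of [(A v + B u) / (v u)]. *)
Lemma partial_fraction_functional N (v u : {poly F}) : coprimep v u ->
  exists nu : nat -> F, forall A B : {poly F}, (size A < size u)%N ->
    (size (A * v + B * u)%R <= N)%N ->
  \sum_(t < N) nu t * (A * v + B * u).[t%:R] = A.[0].
Proof.
move=> /Bezout_eq1_coprimepP[[w t] /= Ewt].
(* Linear in [h], hence a combination of coefficients, to which sampling applies. *)
pose lam (h : {poly F}) := ((h * w) %% u).[0].
have lamE (h : {poly F}) : (size h <= N)%N -> lam h = \sum_(i < N) lam 'X^i * h`_i.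
  move=> sh; rewrite /lam.
  have -> : h * w = \sum_(i < N) h`_i *: ('X^i * w).
    rewrite -[in LHS](coefK h) (poly_def _ (fun i => h`_i)) -(subnKC sh).
    rewrite big_split_ord /= mulr_suml [X in _ + X]big1 ?addr0 => [|i _].
      by apply: eq_bigr => i _; rewrite scalerAl.
    by rewrite nth_default ?scale0r ?leq_addr.
  rewrite (big_morph (fun p : {poly F} => p %% u) (modpD u) (mod0p u)) horner_sum.
  by apply: eq_bigr => i _; rewrite modpZl hornerZ mulrC.
have [nu Enu] := sample_functional N (fun i => lam 'X^i).
exists nu => A B sA sAB; rewrite -Enu // -lamE // /lam.
have -> : (A * v + B * u) * w = A + (B * w - A * t) * u.
  by rewrite -[X in _ = X + _]mulr1 -Ewt; ring.
by rewrite modpD modp_mull addr0 modp_small.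
Qed.

End FieldSeries.

(** * Total degree of bivariate polynomials *)

Section TotalDegree.
Variable F : fieldType.
Implicit Types p q : {poly {poly F}}.

(** The outer variable is [z], the inner one [y]. Truncated subtraction makes the coefficients of
    [z^i] vanish for [i > k]. *)
Definition total_degree_le (k : nat) p : Prop :=
  forall i, (size (p`_i)%R <= k.+1 - i)%N.

Lemma tdeg_leW k l p : (k <= l)%N -> total_degree_le k p -> total_degree_le l p.
Proof. by move=> lekl tp i; apply: leq_trans (tp i) _; lia. Qed.

Lemma tdegD k p q :
  total_degree_le k p -> total_degree_le k q -> total_degree_le k (p + q).
Proof.
move=> tp tq i; rewrite coefD; apply: leq_trans (size_polyD _ _) _.
by rewrite geq_max tp tq.
Qed.

Lemma tdegC k (c : {poly F}) : (size c <= k.+1)%N -> total_degree_le k c%:P.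
Proof. by move=> sc i; rewrite coefC; case: i => [|i]; rewrite ?subn0 ?size_poly0. Qed.

Lemma tdegN k p : total_degree_le k p -> total_degree_le k (- p).
Proof. by move=> tp i; rewrite coefN size_polyN. Qed.

Lemma tdegM k l p q :
  total_degree_le k p -> total_degree_le l q -> total_degree_le (k + l) (p * q).
Proof.
move=> tp tq i; rewrite coefM; apply: (leq_trans (size_sum _ _ _)).
apply/bigmax_leqP => -[j ltj] _ /=.
have sp := tp j; have sq := tq (i - j)%N.
have [->|nz_p] := eqVneq p`_j 0; first by rewrite mul0r size_poly0.
have [->|nz_q] := eqVneq q`_(i - j) 0; first by rewrite mulr0 size_poly0.
apply: (leq_trans (size_polyMleq _ _)).
rewrite -size_poly_gt0 in nz_p; rewrite -size_poly_gt0 in nz_q.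
move: nz_p nz_q sp sq; move: (size p`_j) (size q`_(i - j)); lia.
Qed.

Lemma tdegX k p m : total_degree_le k p -> total_degree_le (k * m) (p ^+ m).
Proof.
move=> tp; elim: m => [|m IH]; last by rewrite exprS mulnS; apply: tdegM.
by rewrite muln0 expr0; apply: tdegC; rewrite size_poly1.
Qed.

Lemma tdeg_sum k (I : Type) (r : seq I) (G : I -> {poly {poly F}}) :
  (forall i, total_degree_le k (G i)) -> total_degree_le k (\sum_(i <- r) G i).
Proof.
move=> tG; elim/big_rec: _ => [i|i p _ tp]; first by rewrite coef0 size_poly0.
exact: tdegD.
Qed.

Lemma tdeg_coef0 k p : total_degree_le k p -> (size (p`_0)%R <= k.+1)%N.
Proof. by move=> tp; have := tp 0%N; rewrite subn0. Qed.

End TotalDegree.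

(** * The truncated logarithm and its additivity *)

Section ScaledLog.
Variable F : fieldType.
Hypothesis F0 : [pchar F] =i pred0.
Implicit Types p f g : {poly {poly F}}.

(** The coefficient of [u^(m+1)] in [log (1 + u)]. *)
Definition log_coef (m : nat) : F := (-1) ^+ m / m.+1%:R.

(* [p0 ^ D * log (p / p0)], truncated, where [p0] is the constant term of [p]. *)
Definition scaled_log (D : nat) p : {poly {poly F}} :=
  \sum_(m < D) (log_coef m)%:P%:P * (p - (p`_0)%:P) ^+ m.+1 * (p`_0)%:P ^+ (D - m.+1).

Lemma scaled_log0 D p : (scaled_log D p)`_0 = 0.
Proof.
rewrite coef_sum big1 // => m _; rewrite mulrAC coefM big_ord1.
rewrite [((p - _) ^+ _)`_ _](_ : _ = 0) ?mulr0 //.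
by rewrite zero_below_exp // coefB coefC subrr.
Qed.

Lemma deriv_mulC (S : nzRingType) (c : S) (q : {poly S}) :
  (c%:P * q)^`() = c%:P * q^`().
Proof. by rewrite mul_polyC derivZ mul_polyC. Qed.

(** With [p0] the constant term, the derivative is [p'] times a geometric sum in [p0] and [p0 - p],
    which the factor [p = p0 - (p0 - p)] telescopes. The term [(p0 - p)^D] is the truncation
    error. *)
Lemma deriv_scaled_log D p :
  p * (scaled_log D p)^`() =
  p^`() * ((p`_0)%:P ^+ D - ((p`_0)%:P - p) ^+ D).
Proof.
rewrite subrXX subKr [RHS]mulrCA; congr (_ * _).
rewrite /scaled_log linear_sum mulr_sumr.
apply: eq_bigr => m _ /=.
have -> : (log_coef m)%:P%:P * (p - (p`_0)%:P) ^+ m.+1 * (p`_0)%:P ^+ (D - m.+1)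
    = ((log_coef m)%:P * p`_0 ^+ (D - m.+1))%:P * (p - (p`_0)%:P) ^+ m.+1.
  by rewrite [LHS]mulrAC -rmorphXn /= -polyCM.
rewrite deriv_mulC deriv_exp.
rewrite derivB derivC subr0 -mulr_natl -[p - _]opprB exprNn /log_coef.
have -> : (p`_0)%:P ^+ (D.-1 - m) = ((p`_0) ^+ (D - m.+1))%:P :> {poly {poly F}}.
  by rewrite rmorphXn; congr (_ ^+ _); lia.
rewrite polyCM.
have -> : (((-1) ^+ m / m.+1%:R)%:P)%:P =
    (-1) ^+ m * (m.+1%:R^-1)%:P%:P :> {poly {poly F}}.
  by rewrite !rmorphM !rmorphXn !rmorphN1.
have Em : (m.+1%:R^-1)%:P%:P * m.+1%:R = 1 :> {poly {poly F}}.
  by rewrite -polyC_natr -polyCM -polyC_natr -polyCM mulVf ?natr_neq0.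
have E1 : (-1) ^+ m * (-1) ^+ m = 1 :> {poly {poly F}}.
  by rewrite -expr2 sqrr_sign.
set A := (m.+1%:R^-1)%:P%:P in Em *; set s := (-1) ^+ m in E1 *.
transitivity ((s * s) * (A * m.+1%:R) *
  (p^`() * ((p`_0)%:P - p) ^+ m * ((p`_0) ^+ (D - m.+1))%:P)).
  by ring.
by rewrite E1 Em !mul1r; ring.
Qed.

Lemma tdeg_scaled_log D k p :
  total_degree_le k p -> total_degree_le (D * k) (scaled_log D p).
Proof.
move=> tp; apply: tdeg_sum => -[m ltm] /=.
have tp0 : total_degree_le k (p`_0)%:P by apply/tdegC/tdeg_coef0.
rewrite -mulrA -[(D * k)%N]add0n; apply: tdegM.
  by apply/tdegC/size_polyC_leq1.
have -> : (D * k = k * m.+1 + k * (D - m.+1))%N by rewrite -mulnDr subnKC // mulnC.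
by apply: tdegM; apply: tdegX => //; apply: tdegD => //; apply: tdegN.
Qed.

(** Additivity of the logarithm, scaled by [(f0^(e+1) g0)^D]. Both sides vanish at [z = 0], so it
    suffices that the derivative of their difference vanishes below order [D]; multiplied by [p],
    that derivative is a combination of the three truncation errors. *)
Lemma scaled_logM D e f g : f`_0 != 0 -> g`_0 != 0 ->
  forall i, (i <= D)%N -> (scaled_log D (f ^+ e.+1 * g))`_i =
    (e.+1%:R * scaled_log D f * (f`_0)%:P ^+ (e * D) * (g`_0)%:P ^+ D
     + scaled_log D g * (f`_0)%:P ^+ (e.+1 * D))`_i.
Proof.
move=> nz_f nz_g; set p := f ^+ e.+1 * g.
have Ep0 : (p`_0)%:P = (f`_0)%:P ^+ e * (f`_0)%:P * (g`_0)%:P.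
  by rewrite -!horner_coef0 /p hornerM horner_exp !rmorphM rmorphXn /= exprSr.
have nz_p : p`_0 != 0.
  by rewrite -polyC_eq0 Ep0 !mulf_neq0 ?expf_neq0 ?polyC_eq0.
set R := _ + _; pose E := scaled_log D p - R.
have low (q : {poly {poly F}}) : zero_below D (((q`_0)%:P - q) ^+ D).
  by apply: zero_below_exp; rewrite coefB coefC subrr.
suff lowE : zero_below D E^`().
  move=> i leiD; apply/eqP; rewrite -subr_eq0 -coefB -/E; apply/eqP.
  case: i leiD => [_|i /lowE].
    rewrite /E /R coefB coefD -!horner_coef0 !hornerM !horner_coef0 !scaled_log0.
    by rewrite !(mulr0, mul0r) addr0 subr0.
  rewrite coef_deriv -mulr_natl => /eqP; rewrite mulf_eq0 -polyC_natr polyC_eq0.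
  by rewrite (negPf (natr_neq0 F0 i)) => /eqP.
apply: (zero_below_cancel nz_p).
set f0 := (f`_0)%:P in R E low Ep0 *; set g0 := (g`_0)%:P in R E low Ep0 *.
have dfe : p^`() = e.+1%:R * f ^+ e * f^`() * g + f ^+ e * f * g^`().
  by rewrite /p derivM deriv_exp -mulr_natl exprSr; ring.
have -> : p * E^`() =
    - (p^`() * ((p`_0)%:P - p) ^+ D)
    + e.+1%:R * f ^+ e * g * f0 ^+ (e * D) * g0 ^+ D * f^`() * (f0 - f) ^+ D
    + f ^+ e * f * f0 ^+ (e.+1 * D) * g^`() * (g0 - g) ^+ D.
  rewrite /E derivB mulrBr deriv_scaled_log /R derivD.
  have -> : (e.+1%:R * scaled_log D f * f0 ^+ (e * D) * g0 ^+ D)^`()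
    = e.+1%:R * f0 ^+ (e * D) * g0 ^+ D * (scaled_log D f)^`().
    have -> : e.+1%:R * scaled_log D f * f0 ^+ (e * D) * g0 ^+ D
      = (e.+1%:R * f0 ^+ (e * D) * g0 ^+ D) * scaled_log D f by ring.
    have -> : e.+1%:R * f0 ^+ (e * D) * g0 ^+ D
      = (e.+1%:R * f`_0 ^+ (e * D) * g`_0 ^+ D)%:P.
      by rewrite !polyCM polyC_natr !rmorphXn.
    by rewrite deriv_mulC.
  have -> : (scaled_log D g * f0 ^+ (e.+1 * D))^`()
    = f0 ^+ (e.+1 * D) * (scaled_log D g)^`().
    by rewrite mulrC /f0 -rmorphXn deriv_mulC.
  have -> : p * (e.+1%:R * f0 ^+ (e * D) * g0 ^+ D * (scaled_log D f)^`() +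
    f0 ^+ (e.+1 * D) * (scaled_log D g)^`()) =
    e.+1%:R * f0 ^+ (e * D) * g0 ^+ D * f ^+ e * g * (f * (scaled_log D f)^`())
    + f0 ^+ (e.+1 * D) * f ^+ e * f * (g * (scaled_log D g)^`()).
    by rewrite /p exprSr; ring.
  rewrite !deriv_scaled_log -/f0 -/g0 dfe Ep0 mulSn exprD !exprMn -exprM.
  by ring.
apply: zero_belowD; first apply: zero_belowD; first apply: zero_belowN.
all: exact/zero_below_mulr/low.
Qed.

End ScaledLog.

(** * Recovery of a factor by the truncated exponential *)

Section FactorSeries.
Variable F : fieldType.
Hypothesis F0 : [pchar F] =i pred0.

Definition exp_poly (D : nat) (p : {poly F}) : {poly F} :=
  \sum_(j < D.+1) (j`!%:R)^-1 *: p ^+ j.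

Lemma deriv_exp_poly D p :
  (exp_poly D p)^`() = p^`() * (exp_poly D p - (D`!%:R)^-1 *: p ^+ D).
Proof.
rewrite /exp_poly [in RHS]big_ord_recr /= addrK linear_sum big_ord_recl /=.
rewrite expr0 derivZ derivC scaler0 add0r mulr_sumr; apply: eq_bigr => j _.
rewrite derivZ deriv_exp /= factS natrM invfM -scalerA -scaler_nat !scalerA.
rewrite -scalerAr; congr (_ *: _).
by rewrite mulrC mulrA mulfV ?mul1r ?natr_neq0.
Qed.

Definition at_y (t : F) : {rmorphism {poly {poly F}} -> {poly F}} :=
  map_poly (horner_eval t).

Lemma coef_at_y t p i : (at_y t p)`_i = (p`_i).[t].
Proof. by rewrite coef_map. Qed.

Lemma at_yC t c : at_y t c%:P = (c.[t])%:P.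
Proof. by rewrite /= map_polyC. Qed.

(* [exp] inverts the truncated logarithm: both [phi] and [c * exp G]
   solve [w' = G' w] up to order [D]. *)
Lemma exp_scaled_log D c (phi G l : {poly F}) : c != 0 -> phi`_0 = c ->
    phi * l^`() = phi^`() * ((c%:P) ^+ D - (c%:P - phi) ^+ D) ->
    G`_0 = 0 -> (forall i, (i <= D)%N -> l`_i = c ^+ D * G`_i) ->
  forall i, (i <= D)%N -> phi`_i = c * (exp_poly D G)`_i.
Proof.
move=> nz_c phi0 dl G0 El.
have W0 : (exp_poly D G)`_0 = 1.
  rewrite -horner_coef0 horner_sum big_ord_recl /= expr0 hornerZ hornerC fact0.
  rewrite invr1 mulr1 big1 ?addr0 // => j _.
  by rewrite hornerZ horner_exp horner_coef0 G0 expr0n mulr0.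
apply: proportional_series => //; rewrite ?W0 ?oner_neq0 ?mulr1 //.
rewrite deriv_exp_poly; set W := exp_poly D G.
have -> : phi^`() * W - phi * (G^`() * (W - (D`!%:R)^-1 *: G ^+ D)) =
    W * (phi^`() - phi * G^`()) + (phi * G^`() * (D`!%:R^-1)%:P) * G ^+ D.
  by rewrite -mul_polyC; ring.
apply: zero_belowD; last exact/zero_below_mulr/zero_below_exp.
apply: zero_below_mulr.
have ncD : c ^+ D != 0 by rewrite expf_neq0.
(* The logarithmic derivative [dl] splits this into the truncation error of the logarithm and [phi]
   times the derivative of [l / c^D - G], both zero below order [D]. *)
have -> : phi^`() - phi * G^`() =
    (phi^`() * ((c ^+ D)^-1)%:P) * (c%:P - phi) ^+ D
    + phi * ((c ^+ D)^-1 *: l - G)^`().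
  rewrite derivB derivZ mulrBr addrA; congr (_ - _).
  rewrite -mul_polyC [phi * _]mulrCA dl.
  have EK : ((c ^+ D)^-1)%:P * c%:P ^+ D = 1 by rewrite -rmorphXn -polyCM mulVf.
  by rewrite -[LHS]mulr1 -EK; ring.
apply: zero_belowD; apply: zero_below_mulr.
  by apply: zero_below_exp; rewrite coefB coefC phi0 subrr.
move=> i ltiD; rewrite coef_deriv coefB coefZ El // mulrA mulVf // mul1r subrr.
by rewrite mul0rn.
Qed.

(** By additivity, each coefficient of the scaled logarithm of the product is [A v + B u] with
    [v = g0^D] and [u = f0^((e+1)D)] coprime, so the partial fraction functional reads off [A] at
    [y = 0]. It depends on [f0] and [g0] only, so one [nu] serves all planes through the same
    line. *)
Lemma factor_series D e df dg (f0 g0 : {poly F}) :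
    f0.[0] != 0 -> g0 != 0 -> coprimep f0 g0 -> size f0 = df.+1 ->
  exists nu : nat -> F, forall f g : {poly {poly F}},
    f`_0 = f0 -> g`_0 = g0 -> total_degree_le df f -> total_degree_le dg g ->
  forall i, (i <= D)%N -> (at_y 0 f)`_i = f0.[0] *
    (exp_poly D (\sum_(t < D * (e.+1 * df + dg)) nu t *:
       at_y t%:R (scaled_log D (f ^+ e.+1 * g))))`_i.
Proof.
move=> nz_c nz_g0 cop sf0; set N := (D * _)%N; set c := f0.[0] in nz_c *.
pose v := g0 ^+ D; pose u := f0 ^+ (e.+1 * D).
have nz_f0 : f0 != 0 by rewrite -size_poly_gt0 sf0.
have u_gt0 : (0 < size u)%N by rewrite size_poly_gt0 expf_neq0.
have cop_vu : coprimep v u by rewrite coprimep_expl // coprimep_expr // coprimep_sym.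
have su : size u = (e.+1 * D * df).+1.
  by rewrite -(prednK u_gt0) size_exp sf0 /= mulnC.
have [nu0 Enu0] := partial_fraction_functional F0 N cop_vu.
(* Since [A] at [y = 0] is [(e+1) c^(eD)] times the scaled logarithm of [f], this factor leaves that
   logarithm divided by [c^D]. *)
pose k := (e.+1%:R * c ^+ (e.+1 * D))^-1.
exists (fun t => k * nu0 t) => f g Ef0 Eg0 tf tg.
set P := f ^+ e.+1 * g.
have nz_ff : f`_0 != 0 by rewrite Ef0.
have nz_gg : g`_0 != 0 by rewrite Eg0.
have tP : total_degree_le (e.+1 * df + dg) P.
  by apply: tdegM => //; rewrite mulnC; apply: tdegX.
have sP i : (size ((scaled_log D P)`_i)%R <= N)%N.
  have := tdeg_scaled_log D tP i; case: i => [|i].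
    by rewrite scaled_log0 size_poly0.
  by rewrite subSS => /leq_trans-> //; apply: leq_subr.
pose A := e.+1%:R * scaled_log D f * (f`_0)%:P ^+ (e * D).
have tA : total_degree_le (e.+1 * D * df) A.
  rewrite /A -mulrA -[(e.+1 * D * df)%N]add0n; apply: tdegM.
    by rewrite -polyC_natr; apply: tdegC; rewrite -polyC_natr size_polyC_leq1.
  have -> : (e.+1 * D * df = D * df + df * (e * D))%N by lia.
  apply: tdegM; first exact: tdeg_scaled_log.
  by apply: tdegX; apply: tdegC; rewrite Ef0 sf0.
have A0 : A`_0 = 0.
  by rewrite -horner_coef0 !hornerM !horner_coef0 scaled_log0 mulr0 mul0r.
(* Strict because [A] has no term of degree 0 in [z], and each [z^i] with [i > 0] takes at least one
   from the degree in [y]. *)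
have sA i : (size (A`_i)%R < size u)%N.
  rewrite su ltnS; case: i => [|i]; first by rewrite A0 size_poly0.
  by have := tA i.+1; rewrite subSS => /leq_trans-> //; apply: leq_subr.
apply: (@exp_scaled_log D c (at_y 0 f) _ (at_y 0 (scaled_log D f))) => //.
- by rewrite coef_at_y Ef0.
- have := congr1 (at_y 0) (deriv_scaled_log F0 D f).
  rewrite !rmorphM !rmorphB !rmorphXn rmorphB at_yC Ef0 -/c /at_y /=.
  by rewrite !deriv_map.
- rewrite coef_sum big1 // => t _.
  by rewrite coefZ coef_at_y scaled_log0 horner0 mulr0.
move=> i leiD; rewrite coef_at_y [X in _ * X]coef_sum.
have Ei : (scaled_log D P)`_i = A`_i * v + (scaled_log D g)`_i * u.
  rewrite (scaled_logM F0 _ nz_ff nz_gg leiD) coefD Ef0 Eg0.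
  by rewrite -!rmorphXn !coefMC /A Ef0 -rmorphXn coefMC.
under eq_bigr do rewrite coefZ coef_at_y -mulrA Ei.
rewrite -mulr_sumr Enu0 ?sA -?Ei //.
have -> : (A`_i).[0] = e.+1%:R * ((scaled_log D f)`_i).[0] * c ^+ (e * D).
  rewrite /A -rmorphXn coefMC -polyC_natr coefCM !hornerM Ef0 horner_exp -/c.
  by rewrite -polyC_natr hornerC.
rewrite /k mulSn exprD; set x := ((scaled_log D f)`_i).[0].
have nD : c ^+ D != 0 by rewrite expf_neq0.
have neD : c ^+ (e * D) != 0 by rewrite expf_neq0.
have ne : e.+1%:R != 0 :> F by apply: natr_neq0.
by move: (e.+1%:R) ne => z ne; field; rewrite nD neD ne.
Qed.

End FactorSeries.

(** * The interpolation formula for a factor *)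

Section Plane.
Variables (F : fieldType) (n : nat).
Implicit Types (a b h : 'I_n -> F) (p : {mpoly F[n]}).

(** The substitution [x := a + y b + z h]: the line [a + y b] at [z = 0], and for [h = x - a] the
    point [x] at [y = 0], [z = 1]. *)
Definition plane_var a b h i : {poly {poly F}} :=
  ((a i)%:P + b i *: 'X)%:P + (h i)%:P *: 'X.

Definition plane a b h : {rmorphism {mpoly F[n]} -> {poly {poly F}}} :=
  mmap (polyC \o polyC) (plane_var a b h).

Lemma planeC a b h c : plane a b h c%:MP = c%:P%:P.
Proof. by rewrite /= mmapC. Qed.

Lemma planeX a b h i : plane a b h 'X_i = plane_var a b h i.
Proof. by rewrite /= mmapX mmap1U. Qed.

Lemma planeE a b h p : plane a b h p =
  \sum_(m <- msupp p) (p@_m)%:P%:P * mmap1 (plane_var a b h) m.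
Proof. by []. Qed.

Opaque plane.

Lemma plane_coef0 a b h p : (plane a b h p)`_0 = line_at a b p.
Proof.
rewrite -horner_coef0; move: p.
apply: (@mpoly_rmorph_eq _ _ _ (horner_eval 0 \o plane a b h) (line_at a b)) => [c|i];
  rewrite -[LHS]/((plane a b h _).[0]).
  by rewrite planeC line_atC hornerC.
by rewrite planeX line_atX /plane_var !hornerE.
Qed.

Lemma plane_eval a b h p t s :
  (at_y t (plane a b h p)).[s] = p.@[fun i => a i + s * h i + t * b i].
Proof.
move: p.
apply: (@mpoly_rmorph_eq _ _ _ (horner_eval s \o at_y t \o plane a b h) (meval _))
  => [c|i]; rewrite -[LHS]/((at_y t (plane a b h _)).[s]).
  by rewrite planeC !at_yC !hornerC /= mevalC.
rewrite planeX [RHS]mevalXU /plane_var -[(h i)%:P *: 'X]mul_polyC rmorphD rmorphM.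
by rewrite !at_yC /= map_polyX !hornerE; ring.
Qed.

Lemma tdeg_plane a b h p : total_degree_le (msize p).-1 (plane a b h p).
Proof.
have tv i : total_degree_le 1 (plane_var a b h i).
  case=> [|[|k]]; rewrite /plane_var coefD coefC coefZ coefX /=.
  - rewrite mulr0 addr0; apply: leq_trans (size_polyD _ _) _; rewrite geq_max.
    apply/andP; split; first by apply: leq_trans (size_polyC_leq1 _) _.
    by apply: leq_trans (size_scale_leq _ _) _; rewrite size_polyX.
  - by rewrite mulr1 add0r size_polyC_leq1.
  - by rewrite mulr0 addr0 size_poly0.
have tm m : total_degree_le (mdeg m) (mmap1 (plane_var a b h) m).
  rewrite mdegE /mmap1; elim/big_rec2: _ => [|i q k _ tq].
    by apply: tdegC; rewrite size_poly1.
  by apply: tdegM => //; rewrite -[X in total_degree_le X]mul1n; apply: tdegX.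
rewrite planeE big_seq; elim/big_rec: _ => [i|m q mp tq].
  by rewrite coef0 size_poly0.
apply: tdegD => //; apply: (@tdeg_leW _ (0 + mdeg m)).
  by have := msize_mdeg_lt mp; lia.
by apply: tdegM => //; apply/tdegC/size_polyC_leq1.
Qed.

End Plane.

(** * The values of [f] from values of [p] *)

Section FactorFormula.
Variables (F : fieldType) (n : nat).
Hypothesis F0 : [pchar F] =i pred0.
Implicit Types (f g p : {mpoly F[n]}).

Lemma irreducible_msize f : irreducible_elt f -> (1 < msize f)%N.
Proof.
by case=> + + _; rewrite mpoly_unit_size -msize_poly_eq0; case: (msize f) => [|[]].
Qed.

Lemma mdegreeM p g : p != 0 -> g != 0 ->
  (msize (p * g)).-1 = ((msize p).-1 + (msize g).-1)%N.
Proof.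
move=> nz_p nz_g; rewrite msizeM // (mpolySpred _ nz_p) (mpolySpred _ nz_g).
by rewrite addnS addSn.
Qed.

Lemma mdegreeX p k : p != 0 -> (msize (p ^+ k)).-1 = (k * (msize p).-1)%N.
Proof.
move=> nz_p; elim: k => [|k IH]; first by rewrite expr0 msize1.
by rewrite exprS mdegreeM ?expf_neq0 // IH mulSn.
Qed.

Lemma multiplicity f p : irreducible_elt f -> p != 0 -> divides f p ->
  exists e g, p = f ^+ e.+1 * g /\ ~ divides f g.
Proof.
move=> f_irr; have sf := irreducible_msize f_irr; have [nz_f _ _] := f_irr.
move sz: (msize p) => k; elim/ltn_ind: k p sz => k IH p sz nz_p [q Eq].
have nz_q : q != 0 by apply: contra_neq nz_p => E; rewrite Eq E mul0r.
have [fq|nfq] := classic (divides f q); last by exists 0%N, q; rewrite expr1 mulrC.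
have ltq : (msize q < k)%N.
  rewrite -sz Eq msizeM //; case: (msize f) sf => [|[|j]] // _.
  by rewrite !addnS /= ltnS leq_addr.
have [e [g [Eg nfg]]] := IH _ ltq q erefl nz_q fq.
by exists e.+1, g; split=> //; rewrite [f ^+ e.+2]exprS Eq Eg mulrC mulrA.
Qed.

(** The scaled logarithm as a univariate polynomial in the value of [p], for a fixed constant term
    [c]; on the planes used, its coefficients do not depend on [x]. *)
Definition log_sample (D : nat) (c : F) : {poly F} :=
  \sum_(m < D) (log_coef F m * c ^+ (D - m.+1)) *: ('X - c%:P) ^+ m.+1.

Lemma size_log_sample D c : (size (log_sample D c) <= D.+1)%N.
Proof.
apply: leq_trans (size_sum _ _ _) _; apply/bigmax_leqP => -[m ltm] _ /=.
by apply: leq_trans (size_scale_leq _ _) _; rewrite size_exp_XsubC.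
Qed.

Lemma at_y_scaled_log D (p : {poly {poly F}}) t s :
  (at_y t (scaled_log D p)).[s] =
  (log_sample D (p`_0).[t]).[(at_y t p).[s]].
Proof.
rewrite /scaled_log rmorph_sum !horner_sum; apply: eq_bigr => m _.
rewrite !rmorphM !rmorphXn rmorphB !at_yC !hornerM !horner_exp !hornerE /=.
by rewrite mulrAC.
Qed.

(** On the plane through [a], [b] and [x], the value [f x] is the sum of the [z]-coefficients of
    degree at most [D] at [y = 0]. These are, up to [c], the coefficients of [exp_poly D G], of
    degree at most [D * D * r], and their sum is a combination of values at
    [z = 0, ..., D * D * r]. *)
Lemma factor_formula r f p : irreducible_elt f -> p != 0 -> divides f p ->
    ((msize p).-1 <= r)%N -> let D := (msize f).-1 in
  exists (a b : 'I_n -> F) (be ga : nat -> nat -> F), forall x : 'I_n -> F,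
  f.@[x] = \sum_(s < (D * D * r).+1) \sum_(j < D.+1) be s j *
    (\sum_(t < D * r) \sum_(m < D.+1) ga t m *
      p.@[fun i => a i + s%:R * (x i - a i) + t%:R * b i] ^+ m) ^+ j.
Proof.
move=> f_irr nz_p fp ler D; have [nz_f nu_f _] := f_irr.
have sf := irreducible_msize f_irr.
have [e [g [Ep nfg]]] := multiplicity f_irr nz_p fp.
have nz_g : g != 0 by apply: contra_neq nz_p => E; rewrite Ep E mulr0.
have [a [b [nz_fa sfl cop]]] :=
  exists_good_line F0 nz_f (irreducible_mpoly_prime f_irr) nfg.
have D_gt0 : (0 < D)%N by rewrite /D; case: (msize f) sf.
have ED : msize f = D.+1 by rewrite /D prednK // ltnW.
pose r0 := (e.+1 * D + (msize g).-1)%N.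
have Er0 : (r0 <= r)%N.
  by apply: leq_trans ler; rewrite Ep mdegreeM ?expf_neq0 // mdegreeX.
have nz_g0 : line_at a b g != 0.
  apply: contraTneq cop => ->; rewrite coprimep0 -size_poly_eq1 sfl ED.
  by rewrite eqSS -lt0n.
have nz_f0 : (line_at a b f).[0] != 0 by rewrite line_at0.
have [nu Enu] := factor_series F0 D e (msize g).-1 nz_f0 nz_g0 cop (etrans sfl ED).
pose N2 := (D * D * r).+1.
(* [beta] expresses the sum of the coefficients of degree at most [D]. *)
have [beta Ebeta] := sample_functional F0 N2 (fun i => (i < D.+1)%:R).
pose c := f.@[a].
pose q t := log_sample D (line_at a b p).[t%:R].
(* Zero weights pad the [D * r0] samples to [D * r], a count that involves only [D] and [r]. *)
pose nu' t := if (t < D * r0)%N then nu t else 0.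
exists a, b, (fun s j => c * beta s / (j`!)%:R), (fun t m => nu' t * (q t)`_m) => x.
pose h i := x i - a i.
pose G := \sum_(t < D * r0) nu t *: at_y t%:R (scaled_log D (plane a b h p)).
have EG s : G.[s] = \sum_(t < D * r) \sum_(m < D.+1) nu' t * (q t)`_m *
      p.@[fun i => a i + s * (x i - a i) + t%:R * b i] ^+ m.
  rewrite horner_sum (big_ord_widen (D * r)
    (fun t => (nu t *: at_y t%:R (scaled_log D (plane a b h p))).[s]));
    last by rewrite leq_mul2l Er0 orbT.
  rewrite big_mkcond; apply: eq_bigr => t _; rewrite /nu'; case: ifP => _; last first.
    by rewrite big1 // => m _; rewrite !mul0r.
  rewrite hornerZ at_y_scaled_log plane_eval plane_coef0 -/(q t).
  rewrite (horner_coef_wide _ (size_log_sample _ _)) mulr_sumr.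
  by apply: eq_bigr => m _; rewrite mulrA.
pose phi := at_y 0 (plane a b h f).
have sphi : (size phi <= D.+1)%N.
  apply/leq_sizeP => i ltDi; rewrite coef_at_y.
  have := tdeg_plane a b h f i; rewrite -/D.
  have -> : (D.+1 - i = 0)%N by apply/eqP; rewrite subn_eq0.
  by rewrite leqn0 size_poly_eq0 => /eqP ->; rewrite horner0.
have -> : f.@[x] = phi.[1].
  by rewrite plane_eval; apply: meval_eq => i; rewrite /h; ring.
have sG : (size G <= (D * r).+1)%N.
  apply/leq_sizeP => i lti; rewrite coef_sum big1 // => t _; rewrite coefZ coef_at_y.
  have := tdeg_scaled_log D (tdeg_plane a b h p) i.
  have -> : ((D * (msize p).-1).+1 - i = 0)%N.
    apply/eqP; rewrite subn_eq0; apply: leq_trans lti.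
    by rewrite ltnS leq_mul2l ler orbT.
  by rewrite leqn0 size_poly_eq0 => /eqP ->; rewrite horner0 mulr0.
have sW : (size (exp_poly D G) <= N2)%N.
  apply: leq_trans (size_sum _ _ _) _; apply/bigmax_leqP => -[j ltj] _ /=.
  apply: leq_trans (size_scale_leq _ _) _; apply: leq_trans (size_poly_exp_leq _ _) _.
  rewrite ltnS; rewrite [(D * D * r)%N]mulnAC; apply: leq_mul => //.
  by case: (size G) sG.
rewrite (horner_coef_wide _ sphi).
transitivity (c * \sum_(i < D.+1) (exp_poly D G)`_i).
  rewrite mulr_sumr; apply: eq_bigr => -[i lti] _ /=; rewrite expr1n mulr1.
  have EP : plane a b h f ^+ e.+1 * plane a b h g = plane a b h p.
    by rewrite Ep [RHS]rmorphM [X in _ = X * _]rmorphXn.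
  have := Enu _ _ (plane_coef0 a b h f) (plane_coef0 a b h g)
    (tdeg_plane a b h f) (tdeg_plane a b h g) i lti.
  by rewrite EP line_at0.
have leDN : (D.+1 <= N2)%N.
  rewrite ltnS -mulnA leq_pmulr // muln_gt0 D_gt0 /=.
  by apply: leq_trans Er0; rewrite /r0 mulSn -addnA ltn_addr.
rewrite (big_ord_widen N2 (fun i => (exp_poly D G)`_i)) // big_mkcond /=.
under eq_bigr => i _.
  rewrite (_ : (if _ then _ else _) = (i < D.+1)%:R * (exp_poly D G)`_i); last first.
    by case: ifP; rewrite ?mul1r ?mul0r.
  over.
rewrite Ebeta // mulr_sumr; apply: eq_bigr => s _.
rewrite horner_sum !mulr_sumr; apply: eq_bigr => j _.
by rewrite hornerZ horner_exp EG !mulrA.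
Qed.

End FactorFormula.

(** * Layered circuits *)

Section Layering.
Variables (V : finType) (wires : V -> seq V) (layer : V -> nat).
Hypothesis layerS : forall v u, u \in wires v -> layer u = (layer v).+1.

Lemma path_layers x p : path (fun v u => u \in wires v) x p ->
  map layer (x :: p) = iota (layer x) (size p).+1.
Proof.
elim: p x => //= y p IH x /andP[xy /IH] /=; rewrite (layerS xy).
by move=> ->.
Qed.

Lemma path_last_layer x p : path (fun v u => u \in wires v) x p ->
  layer (last x p) = (layer x + size p)%N.
Proof.
elim: p x => [|y p IH] x /=; first by rewrite addn0.
by case/andP=> xy /IH ->; rewrite (layerS xy) addnS.
Qed.

Lemma layered_acyclic p : cycle (fun v u => u \in wires v) p -> p = [::].
Proof.
case: p => // x p; rewrite /cycle => /path_last_layer; rewrite last_rcons size_rcons.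
by lia.
Qed.

Lemma path_size_lt x p : path (fun v u => u \in wires v) x p -> (size p < #|V|)%N.
Proof.
move=> pp; have : uniq (x :: p).
  by apply: (@map_uniq _ _ layer); rewrite (path_layers pp) iota_uniq.
by move/card_uniqP => /= <-; apply: max_card.
Qed.

(** Layers increase along a path, so it cannot be prolonged forever and ends at a node without
    wires. *)
Lemma extend_path (stop : pred V) x p : (forall v, nilp (wires v) -> stop v) ->
    path (fun v u => u \in wires v) x p ->
  exists q, path (fun v u => u \in wires v) x (p ++ q) && stop (last x (p ++ q)).
Proof.
move=> stopP; have [k lek] : exists k, (#|V| <= size p + k)%N.
  by exists #|V|; apply: leq_addl.
elim: k p lek => [|k IH] p lek pp.
  by have := path_size_lt pp; rewrite ltnNge -[size p]addn0 lek.
case Ew: (wires (last x p)) => [|u w].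
  by exists [::]; rewrite cats0 pp stopP // Ew.
have [||q] := IH (rcons p u); last by rewrite cat_rcons; exists (u :: q).
  by rewrite size_rcons addSn -addnS.
by rewrite rcons_path pp Ew mem_head.
Qed.

End Layering.

(* Any node may serve as an output, and nodes on layer 0 may be stacked upon. *)
Record dag (F : fieldType) (n : nat) : Type := Dag {
  dnode : finType;
  dlabel : dnode -> label F n;
  dwires : dnode -> seq dnode;
  dlayer : dnode -> nat;
  dval : dnode -> {mpoly F[n]};
  dag_input : forall v, is_input (dlabel v) = nilp (dwires v);
  dag_layer : forall v u, u \in dwires v -> dlayer u = (dlayer v).+1;
  dag_top : forall v, dlayer v = 0%N -> dlabel v = Sum;
  dag_parity : forall v,
    match dlabel v with
    | Sum => ~~ odd (dlayer v)
    | Prod => odd (dlayer v)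
    | _ => true
    end;
  dag_val : forall v, dval v =
    match dlabel v with
    | Const c => c%:MP
    | Var i => 'X_i
    | Sum => \sum_(u <- dwires v) dval u
    | Prod => \prod_(u <- dwires v) dval u
    end
}.

Definition dsize (F : fieldType) (n : nat) (G : dag F n) : nat :=
  (\sum_(v : dnode G) size (dwires v))%N.

Lemma dag_to_circuit (F : fieldType) n (G : dag F n) (o : dnode G) (D : nat) :
    dlayer o = 0%N -> (forall v : dnode G, (dlayer v <= D)%N) ->
  exists C : circuit F n, [/\ layered C, computes C (dval o),
    (circuit_depth C <= D)%N & circuit_size C = dsize G].
Proof.
move=> Eo bound.
pose C := @Circuit F n (dnode G) (@dlabel _ _ G) (@dwires _ _ G) o
  (@dag_input _ _ G) (@layered_acyclic _ _ _ (@dag_layer _ _ G)).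
exists C; split=> //.
- exists (@dlayer _ _ G); split=> //; first exact: dag_layer.
    exact: dag_top.
  exact: dag_parity.
- by exists (@dval _ _ G); split=> // v; rewrite [LHS]dag_val.
apply/bigmax_leqP => k /existsP[p /andP[pp _]].
have := path_last_layer (@dag_layer _ _ G) pp; rewrite Eo add0n size_tuple => <-.
exact: bound.
Qed.

(** Only nodes reachable from the output are kept. Each lies on a path to an input, which bounds its
    layer by the depth; each except the output is the source of a wire, which bounds their
    number. *)
Lemma circuit_to_dag (F : fieldType) n (C : circuit F n) (P : {mpoly F[n]}) :
    layered C -> computes C P ->
  exists (G : dag F n) (o : dnode G),
    [/\ dval o = P, dlayer o = 0%N, (dsize G <= circuit_size C)%N,
        (#|dnode G| <= (circuit_size C).+1)%N
      & forall v : dnode G, (dlayer v <= circuit_depth C)%N].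
Proof.
move=> [layer [layer0 layerS layerT layerP]] [vl [Evl EP]].
pose e : rel (node C) := fun v u => u \in wires v.
pose V := {v in connect e (output C)}.
pose w (v : V) : seq V := pmap insub (wires (val v)).
have Ew (v : V) : map val (w v) = wires (val v).
  rewrite /w (pmap_filter (insubK _)); apply/all_filterP/allP => u uv.
  rewrite /= isSome_insub; apply: connect_trans (valP v) _; exact: connect1.
have wP (v u : V) : u \in w v -> val u \in wires (val v).
  by move=> uv; rewrite -Ew map_f.
have sw (v : V) : size (w v) = size (wires (val v)) by rewrite -Ew size_map.
have wI (v : V) : is_input (node_label (val v)) = nilp (w v).
  by rewrite input_wires /nilp sw.
have wS (v u : V) : u \in w v -> layer (val u) = (layer (val v)).+1.
  by move/wP/layerS.
have wV (v : V) : vl (val v) =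
    match node_label (val v) with
    | Const c => c%:MP
    | Var i => 'X_i
    | Sum => \sum_(u <- w v) vl (val u)
    | Prod => \prod_(u <- w v) vl (val u)
    end.
  by rewrite Evl; case: node_label => //; rewrite -Ew big_map.
pose G := @Dag F n V (fun v => node_label (val v)) w (fun v => layer (val v))
  (fun v => vl (val v)) wI wS (fun v => layerT (val v)) (fun v => layerP (val v)) wV.
have o_conn : connect e (output C) (output C) by exact: connect0.
have big_V (h : node C -> nat) :
    (\sum_(v : V) h (val v) = \sum_(v in connect e (output C)) h v)%N.
  by rewrite [RHS]big_sub.
exists G, (Sub (output C) o_conn); split=> //.
- rewrite /dsize /= (eq_bigr (fun v : V => size (wires (val v)))) //.
  rewrite (big_V (fun v => size (wires v))).
  rewrite /circuit_size [X in (_ <= X)%N](bigID (mem (connect e (output C)))).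
  exact: leq_addr.
- rewrite /= card_sig.
  pose s := output C :: flatten [seq wires v | v <- enum (node C)].
  have -> : (circuit_size C).+1 = size s.
    by rewrite /s /= size_flatten /shape -map_comp sumnE big_map big_enum.
  apply: leq_trans (card_size s); apply: subset_leq_card; apply/subsetP => v.
  case/connectP => p; case/lastP: p => [|p u] pp ->; first by rewrite mem_head.
  move: pp; rewrite rcons_path last_rcons inE => /andP[_ uw].
  apply/orP; right; apply/flattenP; exists (wires (last (output C) p)) => //.
  by apply: map_f; rewrite mem_enum.
move=> [v v_conn] /=; case/connectP: v_conn => p pp ->.
have [q /andP[pq iq]] := @extend_path _ _ _ layerS
  (fun v => is_input (node_label v)) _ _ (fun v => etrans (input_wires v)) pp.
rewrite (path_last_layer layerS pp) layer0 add0n.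
apply: (@leq_trans (size (p ++ q))); first by rewrite size_cat leq_addr.
have ltk := path_size_lt layerS pq.
apply: (@leq_bigmax_cond _ _ (fun k : 'I_#|node C| => k : nat) (Ordinal ltk)).
by apply/existsP; exists (in_tuple (p ++ q)); rewrite pq.
Qed.

(** * Two layers of sums of products on top of a dag *)

Section SumOfProducts.
Variables (F : fieldType) (n : nat) (G : dag F n) (J I : finType) (i0 : I).
Variables (c : J -> I -> F) (w : J -> I -> seq (dnode G)).
Hypothesis w_top : forall j i u, u \in w j i -> dlayer u = 0%N.

(** In order: sum gates, product gates, their constant factors, and the old dag moved two layers
    down, which keeps parities. The element [i0] of [I] keeps sum gates from being empty, as the
    constants do for product gates. *)
Definition sp_node : finType := (J + J * I + J * I + dnode G)%type.

Definition sp_label (v : sp_node) : label F n :=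
  match v with
  | inl (inl (inl _)) => Sum
  | inl (inl (inr _)) => Prod
  | inl (inr (j, i)) => Const n (c j i)
  | inr u => dlabel u
  end.

Definition sp_wires (v : sp_node) : seq sp_node :=
  match v with
  | inl (inl (inl j)) => [seq inl (inl (inr (j, i))) | i <- enum I]
  | inl (inl (inr (j, i))) => inl (inr (j, i)) :: [seq inr u | u <- w j i]
  | inl (inr _) => [::]
  | inr u => [seq inr u' | u' <- dwires u]
  end.

Definition sp_layer (v : sp_node) : nat :=
  match v with
  | inl (inl (inl _)) => 0
  | inl (inl (inr _)) => 1
  | inl (inr _) => 2
  | inr u => (dlayer u).+2
  end.

Definition sp_term j i : {mpoly F[n]} := (c j i)%:MP * \prod_(u <- w j i) dval u.

Definition sp_val (v : sp_node) : {mpoly F[n]} :=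
  match v with
  | inl (inl (inl j)) => \sum_i sp_term j i
  | inl (inl (inr (j, i))) => sp_term j i
  | inl (inr (j, i)) => (c j i)%:MP
  | inr u => dval u
  end.

Lemma sp_input v : is_input (sp_label v) = nilp (sp_wires v).
Proof.
case: v => [[[j|[j i]]|[j i]]|u] //=; last by rewrite dag_input /nilp size_map.
rewrite /nilp size_map -cardE; apply/esym/negbTE; rewrite -lt0n.
by apply/card_gt0P; exists i0.
Qed.

Lemma sp_layerS v u : u \in sp_wires v -> sp_layer u = (sp_layer v).+1.
Proof.
case: v => [[[j|[j i]]|[j i]]|v] //=.
- by case/mapP=> i _ ->.
- by rewrite inE => /predU1P[->|/mapP[x /w_top + ->] /=] // => ->.
- by case/mapP=> x /dag_layer + -> /= => ->.
Qed.

Lemma sp_top v : sp_layer v = 0%N -> sp_label v = Sum.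
Proof. by case: v => [[[j|[j i]]|[j i]]|v]. Qed.

Lemma sp_parity v :
  match sp_label v with
  | Sum => ~~ odd (sp_layer v)
  | Prod => odd (sp_layer v)
  | _ => true
  end.
Proof.
case: v => [[[j|[j i]]|[j i]]|v] //=.
by have := dag_parity v; case: dlabel => //=; rewrite negbK.
Qed.

Lemma sp_valE v : sp_val v =
  match sp_label v with
  | Const c => c%:MP
  | Var i => 'X_i
  | Sum => \sum_(u <- sp_wires v) sp_val u
  | Prod => \prod_(u <- sp_wires v) sp_val u
  end.
Proof.
case: v => [[[j|[j i]]|[j i]]|v] //=.
- by rewrite big_map big_enum.
- by rewrite big_cons big_map.
- by rewrite dag_val; case: dlabel => //; rewrite big_map.
Qed.

Definition sp_dag : dag F n := Dag sp_input sp_layerS sp_top sp_parity sp_valE.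

(** Each term costs one wire into its sum gate, one from its constant and at most [K] from the old
    dag. *)
Lemma sp_size K : (forall j i, (size (w j i) <= K)%N) ->
  (dsize sp_dag <= #|J| * #|I| * K.+2 + dsize G)%N.
Proof.
move=> wK; rewrite /dsize /= !big_sumType /=.
rewrite [X in (_ + X + _)%N]big1 ?addn0; last by case.
rewrite (eq_bigr (fun v => size (dwires v))); last by move=> v _; rewrite size_map.
rewrite leq_add2r.
rewrite (eq_bigr (fun=> #|I|)); last by move=> j _; rewrite size_map -cardE.
rewrite sum_nat_const -[K.+2]addn1 mulnDr muln1 addnC; apply: leq_add => //.
rewrite -card_prod -sum_nat_const; apply: leq_sum => -[j i] _ /=.
by rewrite size_map ltnS.
Qed.

End SumOfProducts.

(* A copy of a circuit with variable [k] replaced by [s X_k + c_k]. A variable on an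
   even layer becomes the sum gate [Scaled + Offset], where [Scaled] is the product
   [Scale * Input]; on an odd layer it becomes a unary product of such a sum gate
   [Affine]. Gadget nodes that are not needed at a given node are isolated. *)
Inductive gadget := Main | Affine | Scaled | Offset | Scale | Input.

Definition gadget_ord (g : gadget) : 'I_6 :=
  match g with
  | Main => inord 0 | Affine => inord 1 | Scaled => inord 2
  | Offset => inord 3 | Scale => inord 4 | Input => inord 5
  end.

Definition ord_gadget (i : 'I_6) : gadget :=
  nth Main [:: Main; Affine; Scaled; Offset; Scale; Input] i.

Lemma gadget_ordK : cancel gadget_ord ord_gadget.
Proof. by case; rewrite /ord_gadget /= inordK. Qed.

Lemma ord_gadgetK : cancel ord_gadget gadget_ord.
Proof.
by move=> [[|[|[|[|[|[|k]]]]]] ltk] //; apply/val_inj; rewrite /= inordK.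
Qed.

HB.instance Definition _ := Finite.copy gadget (can_type gadget_ordK).

Lemma sum_gadget (h : gadget -> nat) : (\sum_g h g =
  h Main + h Affine + h Scaled + h Offset + h Scale + h Input)%N.
Proof.
rewrite (reindex ord_gadget); last first.
  by exists gadget_ord => g _; [apply: ord_gadgetK | apply: gadget_ordK].
by rewrite !big_ord_recl big_ord0 /= /ord_gadget /= addn0 !addnA.
Qed.

Section AffineCopies.
Variables (F : fieldType) (n : nat) (G : dag F n) (I : finType).
Variables (s : I -> F) (c : I -> 'I_n -> F).

Definition affine_subst i : {rmorphism {mpoly F[n]} -> {mpoly F[n]}} :=
  mmap (@mpolyC n F) (fun k => (s i)%:MP * 'X_k + (c i k)%:MP).

Definition var_of (l : label F n) : option 'I_n :=
  if l is Var k then Some k else None.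

Definition ac_node : finType := (I * dnode G * gadget)%type.

Definition ac_label (x : ac_node) : label F n :=
  let: (i, v, g) := x in
  match g with
  | Main => if var_of (dlabel v) is Some _
            then if odd (dlayer v) then Prod else Sum else dlabel v
  | Affine => if var_of (dlabel v) is Some _
              then if odd (dlayer v) then Sum else Const n 0 else Const n 0
  | Scaled => if var_of (dlabel v) is Some _ then Prod else Const n 0
  | Offset => if var_of (dlabel v) is Some k then Const n (c i k) else Const n 0
  | Scale => Const n (s i)
  | Input => if var_of (dlabel v) is Some k then Var F k else Const n 0
  end.

Definition ac_wires (x : ac_node) : seq ac_node :=
  let: (i, v, g) := x in
  match g with
  | Main => if var_of (dlabel v) is Some _
            then if odd (dlayer v) then [:: (i, v, Affine)]
                 else [:: (i, v, Scaled); (i, v, Offset)]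
            else [seq (i, u, Main) | u <- dwires v]
  | Affine => if var_of (dlabel v) is Some _
              then if odd (dlayer v) then [:: (i, v, Scaled); (i, v, Offset)] else [::]
              else [::]
  | Scaled => if var_of (dlabel v) is Some _
              then [:: (i, v, Scale); (i, v, Input)] else [::]
  | _ => [::]
  end.

(** All gadgets except [Main] get positive layers even when isolated, since layer 0 admits only sum
    gates. *)
Definition ac_layer (x : ac_node) : nat :=
  let: (_, v, g) := x in
  (dlayer v + match g with
              | Main => 0
              | Affine => 1
              | Scaled | Offset => (odd (dlayer v)).+1
              | Scale | Input => (odd (dlayer v)).+2
              end)%N.

Definition ac_val (x : ac_node) : {mpoly F[n]} :=
  let: (i, v, g) := x in
  match g with
  | Main => affine_subst i (dval v)
  | Affine => if var_of (dlabel v) is Some _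
              then if odd (dlayer v) then affine_subst i (dval v) else 0 else 0
  | Scaled => if var_of (dlabel v) is Some k then (s i)%:MP * 'X_k else 0
  | Offset => if var_of (dlabel v) is Some k then (c i k)%:MP else 0
  | Scale => (s i)%:MP
  | Input => if var_of (dlabel v) is Some k then 'X_k else 0
  end.

Lemma ac_input x : is_input (ac_label x) = nilp (ac_wires x).
Proof.
case: x => -[i v] [] //=; try by case: (var_of _) => // k; case: odd.
have := dag_input v; case El: (dlabel v) => [a|k||] /=; rewrite /nilp ?size_map //.
by case: odd.
Qed.

Lemma ac_layerS x y : y \in ac_wires x -> ac_layer y = (ac_layer x).+1.
Proof.
case: x => -[i v] [] //=; case: (var_of _) => [k|] //=.
- case Eo: odd; rewrite !inE; first by move/eqP->; rewrite /= addn0 addn1.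
  by case/orP=> /eqP-> /=; rewrite Eo addn0 addn1.
- by case/mapP=> u /dag_layer + -> /= => ->; rewrite !addn0.
- by case Eo: odd => //; rewrite !inE => /orP[] /eqP-> /=; rewrite Eo addn1 addn2.
- by rewrite !inE => /orP[] /eqP-> /=; rewrite !addnS.
Qed.

Lemma ac_top x : ac_layer x = 0%N -> ac_label x = Sum.
Proof.
case: x => -[i v] []; rewrite /= ?addnS //= addn0 => Ev.
by rewrite (dag_top Ev).
Qed.

Lemma ac_parity x :
  match ac_label x with
  | Sum => ~~ odd (ac_layer x)
  | Prod => odd (ac_layer x)
  | _ => true
  end.
Proof.
case: x => -[i v] []; rewrite /= ?addn0 ?addn1.
- by have := dag_parity v; case: dlabel => //= k _; case Eo: odd; rewrite ?Eo.
- by case: (var_of _) => //= k; case Eo: odd => //=; rewrite negbK Eo.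
- by case: (var_of _) => //= k; rewrite addnS /= oddD oddb addbb.
- by case: (var_of _).
- by [].
- by case: (var_of _).
Qed.

Lemma affine_substX i k : affine_subst i 'X_k = (s i)%:MP * 'X_k + (c i k)%:MP.
Proof. by rewrite /= mmapX mmap1U. Qed.

Lemma affine_substC i a : affine_subst i a%:MP = a%:MP.
Proof. by rewrite /= mmapC. Qed.

Opaque affine_subst.

Lemma ac_valE x : ac_val x =
  match ac_label x with
  | Const a => a%:MP
  | Var k => 'X_k
  | Sum => \sum_(y <- ac_wires x) ac_val y
  | Prod => \prod_(y <- ac_wires x) ac_val y
  end.
Proof.
case: x => -[i v] [] //=.
- rewrite dag_val; case El: (dlabel v) => [a|k||] /=.
  + by rewrite affine_substC.
  + case Eo: odd; first by rewrite big_seq1 /= El /= Eo dag_val El.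
    by rewrite big_cons big_seq1 /= El /= affine_substX.
  + by rewrite big_map rmorph_sum.
  + by rewrite big_map rmorph_prod.
- rewrite dag_val; case El: (dlabel v) => [a|k||] //=; rewrite ?mpolyC0 //.
  case Eo: odd; rewrite ?mpolyC0 // big_cons big_seq1 /= El /=.
  by rewrite affine_substX.
- case El: (dlabel v) => [a|k||] //=; rewrite ?mpolyC0 //.
  by rewrite big_cons big_seq1 /= El.
- by case: (var_of _) => //=; rewrite mpolyC0.
- by case: (var_of _) => //=; rewrite mpolyC0.
Qed.

Definition ac_dag : dag F n := Dag ac_input ac_layerS ac_top ac_parity ac_valE.

Lemma ac_layer_le D : (forall v : dnode G, (dlayer v <= D)%N) ->
  forall x : dnode ac_dag, (dlayer x <= D + 3)%N.
Proof.
move=> lD [[i v] g] /=; apply: leq_add => //.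
by case: g => //; case: odd.
Qed.

(** The worst case is a variable on an odd layer: one wire into [Main], two into [Affine] and two
    into [Scaled]. *)
Lemma ac_size : (dsize ac_dag <= #|I| * (dsize G + 5 * #|dnode G|))%N.
Proof.
rewrite /dsize /=.
rewrite (eq_bigr (fun x : I * dnode G * gadget => size (ac_wires (x.1, x.2))));
  last by case.
rewrite -(pair_bigA _ (fun (p : I * dnode G) g => size (ac_wires (p, g)))) /=.
have -> : (#|I| * (\sum_(v : dnode G) size (dwires v) + 5 * #|dnode G|) =
   \sum_(p : I * dnode G) (size (dwires p.2) + 5))%N.
  rewrite -(pair_bigA _ (fun (i : I) (v : dnode G) => (size (dwires v) + 5)%N)) /=.
  by rewrite sum_nat_const big_split /= sum_nat_const [(5 * _)%N]mulnC.
apply: leq_sum => -[i v] _ /=.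
rewrite sum_gadget /=; case: (var_of _) => [k|] /=; last first.
  by rewrite size_map !addn0 leq_addr.
by case: odd => /=; lia.
Qed.

End AffineCopies.

(** * The circuit of the formula and its size *)

Lemma mpoly_eval_inj (F : fieldType) (F0 : [pchar F] =i pred0) n (p q : {mpoly F[n]}) :
  (forall x, p.@[x] = q.@[x]) -> p = q.
Proof.
move=> Epq; apply/eqP; rewrite -subr_eq0; apply/negPn/negP => /(mpoly_nonroot F0)[x].
by rewrite mevalB Epq subrr eqxx.
Qed.

Lemma affine_subst_eval (F : fieldType) n (I : finType) (s : I -> F)
    (c : I -> 'I_n -> F) i (p : {mpoly F[n]}) x :
  (affine_subst s c i p).@[x] = p.@[fun k => s i * x k + c i k].
Proof.
move: p; apply: (@mpoly_rmorph_eq _ _ _ (meval x \o affine_subst s c i) (meval _))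
  => [a|k]; rewrite -[LHS]/((affine_subst s c i _).@[x]).
  by rewrite affine_substC /= !mevalC.
by rewrite affine_substX /= mevalD mevalM !mevalC !mevalXU.
Qed.

(** Affine copies of [G] indexed by [(s, t)] add 3 layers; sums over [(t, m)] for each [s], then the
    sum over [(s, j)], add 2 each. Powers are products over parallel wires. Bounds are successors so
    that the index types are inhabited. *)
Lemma formula_circuit (F : fieldType) n (G : dag F n) (o : dnode G) (D N1 N2 K : nat)
    (a b : 'I_n -> F) (be ga : nat -> nat -> F) :
    dlayer o = 0%N -> (forall v : dnode G, (dlayer v <= D)%N) ->
    [pchar F] =i pred0 -> forall f : {mpoly F[n]},
    (forall x : 'I_n -> F,
      f.@[x] = \sum_(s < N2.+1) \sum_(j < K.+1) be s j *
        (\sum_(t < N1.+1) \sum_(m < K.+1) ga t m *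
          (dval o).@[fun i => a i + s%:R * (x i - a i) + t%:R * b i] ^+ m) ^+ j) ->
  exists C : circuit F n, [/\ layered C, computes C f, (circuit_depth C <= D + 7)%N
    & (circuit_size C <=
        N2.+1 * K.+1 * K.+2 + (N2.+1 * (N1.+1 * K.+1) * K.+2
        + N2.+1 * N1.+1 * (dsize G + 5 * #|dnode G|)))%N].
Proof.
move=> Eo bound F0 f Ef.
pose I1 : finType := ('I_N2.+1 * 'I_N1.+1)%type.
pose sc (i : I1) : F := (i.1 : nat)%:R.
pose off (i : I1) k : F := a k - (i.1 : nat)%:R * a k + (i.2 : nat)%:R * b k.
pose G1 := ac_dag G sc off.
pose w2 (s : 'I_N2.+1) (i : 'I_N1.+1 * 'I_K.+1) : seq (dnode G1) :=
  nseq i.2 ((s, i.1), o, Main).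
have w2_top s i u : u \in w2 s i -> dlayer u = 0%N.
  by rewrite mem_nseq => /andP[_ /eqP->]; rewrite /= addn0.
pose G2 := @sp_dag F n G1 _ _ (ord0, ord0) (fun _ i => ga i.1 i.2) w2 w2_top.
pose w3 (_ : unit) (i : 'I_N2.+1 * 'I_K.+1) : seq (dnode G2) :=
  nseq i.2 (inl (inl (inl i.1))).
have w3_top j i u : u \in w3 j i -> dlayer u = 0%N.
  by rewrite mem_nseq => /andP[_ /eqP->].
pose G3 := @sp_dag F n G2 _ _ (ord0, ord0) (fun _ i => be i.1 i.2) w3 w3_top.
pose o3 : dnode G3 := inl (inl (inl tt)).
have bound3 (v : dnode G3) : (dlayer v <= D + 7)%N.
  have l1 := ac_layer_le bound.
  have l2 (u : dnode G2) : (dlayer u <= D + 5)%N.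
    case: u => [[[?|?]|?]|u]; rewrite [dlayer _]/= !addnS //.
    by rewrite !ltnS -!addnS; apply: l1.
  case: v => [[[?|?]|?]|u]; rewrite [dlayer _]/= !addnS //.
  by rewrite !ltnS -!addnS; apply: l2.
have [C [lC cC dC sC]] := @dag_to_circuit F n G3 o3 (D + 7) erefl bound3.
exists C; split=> //.
  suff <- : dval o3 = f by [].
  apply: (mpoly_eval_inj F0) => x; rewrite Ef /= raddf_sum /=.
  rewrite [RHS]pair_bigA /=.
  apply: eq_bigr => -[s j] _ /=.
  rewrite /sp_term /w3 mevalM mevalC big_nseq iter_mulr_1 rmorphXn /=.
  congr (_ * _ ^+ _).
  rewrite raddf_sum /= [RHS]pair_bigA /=.
  apply: eq_bigr => -[t m] _ /=.
  rewrite /sp_term /w2 mevalM mevalC big_nseq iter_mulr_1 rmorphXn /=.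
  congr (_ * _ ^+ _).
  apply: etrans (affine_subst_eval sc off (s, t) (dval o) x) _.
  by apply: meval_eq => k; rewrite /sc /off /=; ring.
rewrite sC; apply: leq_trans (@sp_size _ _ _ _ _ _ _ _ w3_top K _) _.
  by move=> j [s m]; rewrite size_nseq -ltnS.
rewrite card_unit mul1n card_prod !card_ord leq_add2l.
apply: leq_trans (@sp_size _ _ _ _ _ _ _ _ w2_top K _) _.
  by move=> j [s m]; rewrite size_nseq -ltnS.
rewrite card_prod !card_ord leq_add2l; apply: leq_trans (ac_size _ _ _) _.
by rewrite card_prod !card_ord.
Qed.

Theorem theorem2p1 :
  exists a b c k : nat,
  forall (F : fieldType) (n r s d Delta : nat) (P f : {mpoly F[n]}),
    [pchar F] =i pred0 ->
    P != 0 ->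
    ((msize P).-1 <= r)%N ->
    (exists C : circuit F n,
       [/\ layered C, computes C P, circuit_size C = s
         & (circuit_depth C <= Delta)%N]) ->
    irreducible_mpoly f ->
    ((msize f).-1 <= d)%N ->
    mpoly_divides f P ->
    exists C : circuit F n,
      [/\ layered C, computes C f,
          (circuit_depth C <= Delta + a)%N
        & (circuit_size C <=
             b * ((s + r + n) ^ k * d ^ (c * Nat.sqrt d)))%N].
Proof.
(* Depth grows by 7. With [T = s + r + n], the three parts of the size are at most [12 T^5],
   [12 T^7] and [22 T^6], whence 46 and exponent 7; [c = 0] makes the last factor 1. *)
exists 7%N, 46%N, 0%N, 7%N => F n r s d Delta P f F0 nz_P degP.
move=> [C [lC cC sC dC]] f_irr _ fP.
have [G [o [Eo Lo sG nG lG]]] := circuit_to_dag lC cC.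
have [a [b [be [ga Ef]]]] := factor_formula F0 f_irr nz_P fP degP.
set D := (msize f).-1 in Ef.
have D_gt0 : (0 < D)%N.
  by rewrite /D; case: (msize f) (irreducible_msize f_irr) => [|[]].
have leDr : (D <= r)%N.
  case: fP => q Eq; have [nz_f _ _] := f_irr.
  have nz_q : q != 0 by apply: contra_neq nz_P => E; rewrite Eq E mul0r.
  by apply: leq_trans degP; rewrite Eq mdegreeM // leq_addl.
have r_gt0 : (0 < r)%N by apply: leq_trans leDr.
have EN1 : (D * r = (D * r).-1.+1)%N by rewrite prednK // muln_gt0 D_gt0.
rewrite EN1 -Eo in Ef.
have bound v : (dlayer (v : dnode G) <= Delta)%N by apply: leq_trans (lG v) dC.
have [C' [lC' cC' dC' sC']] := formula_circuit Lo bound F0 Ef.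
exists C'; split=> //; apply: leq_trans sC' _.
rewrite mul0n expn0 muln1 -EN1; rewrite sC in sG nG.
set T := (s + r + n)%N.
have rT : (r <= T)%N by rewrite /T; lia.
have sT : (s <= T)%N by rewrite /T; lia.
have T_gt0 : (0 < T)%N by apply: leq_trans rT.
have DT : (D <= T)%N by apply: leq_trans rT.
have b1 : (D * r <= T * T)%N by apply: leq_mul.
have b2 : ((D * D * r).+1 <= 2 * (T * T * T))%N.
  have : (D * D * r <= T * T * T)%N by rewrite !leq_mul.
  by have : (0 < T * T * T)%N; rewrite ?muln_gt0 ?T_gt0 //; lia.
have b3 : (D.+1 <= 2 * T)%N by lia.
have b4 : (D.+2 <= 3 * T)%N by lia.
(* At most [s] wires and [s + 1] nodes give [6 s + 5]. *)
have b5 : (dsize G + 5 * #|dnode G| <= 11 * T)%N by lia.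
have p5 : (T ^ 5 <= T ^ 7)%N by apply: leq_pexp2l.
have p6 : (T ^ 6 <= T ^ 7)%N by apply: leq_pexp2l.
have -> : (46 * T ^ 7 = 12 * T ^ 7 + (12 * T ^ 7 + 22 * T ^ 7))%N by lia.
apply: leq_add; last apply: leq_add.
- apply: leq_trans (leq_mul (leq_mul b2 b3) b4) _.
  by apply: leq_trans (leq_mul (leqnn 12) p5); rewrite !expnS expn0; nia.
- apply: leq_trans (leq_mul (leq_mul b2 (leq_mul b1 b3)) b4) _.
  by rewrite !expnS expn0; nia.
- apply: leq_trans (leq_mul (leq_mul b2 b1) b5) _.
  by apply: leq_trans (leq_mul (leqnn 22) p6); rewrite !expnS expn0; nia.
Qed.
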